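(* Let $\Gamma\curvearrowright X$ be an action of a discrete group $\Gamma$ by homeomorphisms on a compact and totally disconnected (Hausdorff) space $X$, and let $G=X\rtimes\Gamma$ denote the resulting ample, \'etale transformation groupoid. Then $S(G)$ and $S(X,\Gamma)$ are isomorphic as preordered abelian monoids.
   Context: All topological groupoids are assumed locally compact, second countable and Hausdorff. Transformation groupoid: $G=\Gamma\times X$ with the product topology, unit space $\{e\}\times X$ identified with $X$, $s(t,x)=x$, $r(t,x)=t.x$, and $(t',y)(t,x)=(t't,x)$ when $y=t.x$. Type semigroup of an ample \'etale groupoid $G$: a compact open bisection is a compact open set $E\subseteq G$ on which $r$ and $s$ are homeomorphisms onto open subsets of $G^{(0)}$. Let $C_c(G^{(0)},\mathbb{Z})^+$ be the non-negative compactly supported continuous integer-valued functions on $G^{(0)}$. Write $f\sim_G g$ if there are compact open bisections $E_1,\dots,E_n$ with $f=\sum_{i=1}^n\mathbf{1}_{s(E_i)}$ and $g=\sum_{i=1}^n\mathbf{1}_{r(E_i)}$; this is an equivalence relation. $S(G):=C_c(G^{(0)},\mathbb{Z})^+/\!\sim_G$, with addition $[f]_G+[g]_G=[f+g]_G$. Type semigroup $S(X,\Gamma)$ of R{\o}rdam--Sierakowski: its elements are equivalence classes of sets of the form $A=\bigsqcup_{i=1}^n A_i\times\{i\}\subseteq X\times\mathbb{N}$ with $n\in\mathbb{N}$ and $A_i\subseteq X$ compact open, where $A\sim B$ if there are $l\in\mathbb{N}$, compact open sets $C_1,\dots,C_l\subseteq X$, elements $t_1,\dots,t_l\in\Gamma$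 and natural numbers $n_1,\dots,n_l,m_1,\dots,m_l$ with $A=\bigsqcup_{k=1}^l C_k\times\{n_k\}$ and $B=\bigsqcup_{k=1}^l t_k.C_k\times\{m_k\}$. Addition is $\big[\bigsqcup_{i=1}^n A_i\times\{i\}\big]+\big[\bigsqcup_{j=1}^m B_j\times\{j\}\big]=\big[\bigsqcup_{i=1}^n A_i\times\{i\}\sqcup\bigsqcup_{j=1}^m B_j\times\{n+j\}\big]$. Both monoids carry the algebraic preorder: $x\le y$ iff $x+z=y$ for some $z$. *)

(* Defs.v *)
From HB Require Import structures.
From mathcomp Require Import all_boot all_order all_algebra.
From mathcomp Require Import generic_quotient all_classical topology numfun.
Set Implicit Arguments.
Unset Strict Implicit.
Unset Printing Implicit Defensive.
Import Order.TTheory GRing.Theory Num.Theory.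
Local Open Scope classical_set_scope.
Local Open Scope ring_scope.

Definition homeomorphism_on {T U : topologicalType} (E : set T) (f : T -> U) :=
  {within E, continuous f} /\
  exists2 g : U -> T,
    {within f @` E, continuous g} & (forall x, E x -> g (f x) = x).

Definition local_homeomorphism {T U : topologicalType} (f : T -> U) :=
  forall x, exists2 V : set T,
    open V /\ V x & open (f @` V) /\ homeomorphism_on V f.

(* [arrow] is the groupoid itself and [object] its unit space, identified with
   a subspace of [arrow] by [gunit]; [gunit] is an embedding because [gsrc] is
   a continuous left inverse.  The value of [gmul g h] is meaningful only
   when [gsrc g = grng h]. *)
Record topGroupoid := TopGroupoid {
  arrow : topologicalType;
  object : topologicalType;
  gsrc : arrow -> object;
  grng : arrow -> object;
  gunit : object -> arrow;
  gmul : arrow -> arrow -> arrow;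
  ginv : arrow -> arrow;
  gsrc_unit : forall x, gsrc (gunit x) = x;
  grng_unit : forall x, grng (gunit x) = x;
  gsrc_mul : forall g h, gsrc g = grng h -> gsrc (gmul g h) = gsrc h;
  grng_mul : forall g h, gsrc g = grng h -> grng (gmul g h) = grng g;
  gmulA : forall g h k, gsrc g = grng h -> gsrc h = grng k ->
    gmul g (gmul h k) = gmul (gmul g h) k;
  gmul1 : forall g, gmul g (gunit (gsrc g)) = g;
  g1mul : forall g, gmul (gunit (grng g)) g = g;
  gsrc_inv : forall g, gsrc (ginv g) = grng g;
  grng_inv : forall g, grng (ginv g) = gsrc g;
  gmulV : forall g, gmul g (ginv g) = gunit (grng g);
  gVmul : forall g, gmul (ginv g) g = gunit (gsrc g);
  gsrc_continuous : continuous gsrc;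
  grng_continuous : continuous grng;
  gunit_continuous : continuous gunit;
  gmul_continuous :
    {within [set p : arrow * arrow | gsrc p.1 = grng p.2],
      continuous (fun p : arrow * arrow => gmul p.1 p.2)};
  ginv_continuous : continuous ginv;
  arrow_locally_compact : locally_compact [set: arrow];
  arrow_second_countable : @second_countable arrow;
  arrow_hausdorff : hausdorff_space arrow
}.

Definition compact_open_bisection (G : topGroupoid) (E : set (arrow G)) :=
  [/\ compact E, open E,
      open (@gsrc G @` E) /\ homeomorphism_on E (@gsrc G) &
      open (@grng G @` E) /\ homeomorphism_on E (@grng G)].

Definition etale (G : topGroupoid) :=
  local_homeomorphism (@gsrc G) /\ local_homeomorphism (@grng G).

Definition ample (G : topGroupoid) := basis (@compact_open_bisection G).

Record ampleGroupoid := AmpleGroupoid {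
  ample_groupoid :> topGroupoid;
  ample_etale : etale ample_groupoid;
  ample_ample : ample ample_groupoid
}.

Record preMonoid := PreMonoid {
  pm_sort : Type;
  pm_eqv : pm_sort -> pm_sort -> Prop;
  pm_zero : pm_sort;
  pm_add : pm_sort -> pm_sort -> pm_sort;
  pm_refl : forall x, pm_eqv x x;
  pm_sym : forall x y, pm_eqv x y -> pm_eqv y x;
  pm_trans : forall x y z, pm_eqv x y -> pm_eqv y z -> pm_eqv x z;
  pm_addP : forall x x' y y', pm_eqv x x' -> pm_eqv y y' ->
    pm_eqv (pm_add x y) (pm_add x' y');
  pm_addA : forall x y z,
    pm_eqv (pm_add x (pm_add y z)) (pm_add (pm_add x y) z);
  pm_addC : forall x y, pm_eqv (pm_add x y) (pm_add y x);
  pm_add0 : forall x, pm_eqv (pm_add pm_zero x) x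
}.

Definition pm_car (P : preMonoid) : Type := pm_sort P.
HB.instance Definition _ (P : preMonoid) := gen_eqMixin (pm_car P).
HB.instance Definition _ (P : preMonoid) := gen_choiceMixin (pm_car P).

Section QuotientMonoid.
Variable P : preMonoid.

Definition pm_rel (x y : pm_car P) : bool := `[< pm_eqv x y >].

Lemma pm_rel_refl : reflexive pm_rel.
Proof. by move=> x; apply/asboolP; exact: pm_refl. Qed.
Lemma pm_rel_sym : symmetric pm_rel.
Proof. by move=> x y; apply/asboolP/asboolP; exact: pm_sym. Qed.
Lemma pm_rel_trans : transitive pm_rel.
Proof.
by move=> y x z /asboolP xy /asboolP yz; apply/asboolP; exact: pm_trans xy yz.
Qed.

Canonical pm_equiv_rel := EquivRel pm_rel pm_rel_refl pm_rel_sym pm_rel_trans.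

Definition quotient_monoid := {eq_quot pm_equiv_rel}%qT.
HB.instance Definition _ := Choice.on quotient_monoid.

Definition qclass (x : pm_sort P) : quotient_monoid :=
  \pi_({eq_quot pm_equiv_rel}%qT)%qT (x : pm_car P).
Definition qrepr (a : quotient_monoid) : pm_sort P :=
  generic_quotient.repr (a : {eq_quot pm_equiv_rel}%qT).

Lemma qreprK a : qclass (qrepr a) = a.
Proof. exact: generic_quotient.reprK. Qed.

Lemma qclassP x y : qclass x = qclass y <-> pm_eqv x y.
Proof.
split=> [/generic_quotient.eqmodP/asboolP //|xy].
by apply/generic_quotient.eqmodP/asboolP.
Qed.

Definition qadd (a b : quotient_monoid) := qclass (pm_add (qrepr a) (qrepr b)).

Lemma qaddE x y : qadd (qclass x) (qclass y) = qclass (pm_add x y).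
Proof. by apply/qclassP/pm_addP; apply/qclassP; rewrite qreprK. Qed.

Fact qaddA : associative qadd.
Proof.
move=> a b c; rewrite -(qreprK a) -(qreprK b) -(qreprK c) !qaddE.
exact/qclassP/pm_addA.
Qed.
Fact qaddC : commutative qadd.
Proof.
move=> a b; rewrite -(qreprK a) -(qreprK b) !qaddE; exact/qclassP/pm_addC.
Qed.
Fact qadd0 : left_id (qclass (pm_zero P)) qadd.
Proof. move=> a; rewrite -(qreprK a) !qaddE; exact/qclassP/pm_add0. Qed.

HB.instance Definition _ :=
  GRing.isNmodule.Build quotient_monoid qaddA qaddC qadd0.

End QuotientMonoid.

Definition alg_le {M : nmodType} (x y : M) : Prop := exists z, x + z = y.

Definition preordered_monoid_iso (M N : nmodType) (phi : M -> N) : Prop :=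
  [/\ bijective phi, phi 0 = 0, {morph phi : x y / x + y} &
      forall x y, alg_le x y <-> alg_le (phi x) (phi y)].

Record CcZplus (X : topologicalType) := MkCcZplus {
  Cc_fun :> X -> int;
  Cc_continuous : continuous (Cc_fun : X -> discrete_topology int);
  Cc_compact_support : compact (closure [set x | Cc_fun x != 0]);
  Cc_ge0 : forall x, 0 <= Cc_fun x
}.

Definition groupoid_equiv (G : topGroupoid) (f g : CcZplus (object G)) : Prop :=
  exists (n : nat) (E : 'I_n -> set (arrow G)),
    [/\ forall i, compact_open_bisection (E i),
        forall x, f x = \sum_(i < n) \1_(@gsrc G @` E i) x &
        forall x, g x = \sum_(i < n) \1_(@grng G @` E i) x].

Section Combinatorics.

Lemma rank_sum m (b : 'I_m -> bool) (k : nat) :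
  (\sum_(j < m) (b j && (k == \sum_(i < m | (i < j)%N) b i)%N) =
   (k < \sum_(j < m) b j))%N.
Proof.
elim: m b k => [|m IH] b k; first by rewrite !big_ord0.
rewrite !big_ord_recr /=.
have -> : (\sum_(i < m.+1 | (i < m)%N) b i = \sum_(i < m) b (widen_ord (leqnSn m) i))%N.
  rewrite big_mkcond big_ord_recr /= ltnn addn0; apply: eq_bigr => i _.
  by rewrite ltn_ord.
have -> : (\sum_(i < m) (b (widen_ord (leqnSn m) i) &&
    (k == \sum_(i0 < m.+1 | (i0 < i)%N) b i0)) =
   (k < \sum_(j < m) b (widen_ord (leqnSn m) j)))%N.
  rewrite -IH; apply: eq_bigr => i _; congr (nat_of_bool (_ && (_ == _))).
  rewrite big_mkcond big_ord_recr /= ltnNge (ltnW (ltn_ord i)) addn0.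
  by rewrite [RHS]big_mkcond.
set S := (\sum_(i < m) _)%N.
case: (b ord_max) => /=; last by rewrite !addn0.
by rewrite addn1 ltnS; case: (ltngtP k S).
Qed.

Lemma sum_rank_le m (b : 'I_m -> bool) (j : 'I_m) : b j ->
  (\sum_(i < m | (i < j)%N) b i < \sum_(i < m) b i)%N.
Proof.
move=> bj; rewrite [X in (_ < X)%N](bigID (fun i : 'I_m => (i < j)%N)) /=.
rewrite -[X in (X < _)%N]addn0 ltn_add2l (bigD1 j) /= ?ltnn// bj.
by rewrite add1n.
Qed.

(* Pairs of families with the same sum of indicators have a common
   refinement, obtained by matching the [k]-th sets containing a point. *)
Definition rank_match T n m (A : 'I_n -> set T) (B : 'I_m -> set T) i j :=
  [set x | [/\ A i x, B j x &
    (\sum_(i' < n | (i' < i)%N) (x \in A i') =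
     \sum_(j' < m | (j' < j)%N) (x \in B j'))%N]].

Lemma rank_match_sum T n m (A : 'I_n -> set T) (B : 'I_m -> set T) x i :
  (\sum_(i < n) (x \in A i) = \sum_(j < m) (x \in B j))%N ->
  (\sum_(j < m) (x \in rank_match A B i j) = (x \in A i))%N.
Proof.
move=> AB; have [Ai|Ai] := boolP (x \in A i); last first.
  by rewrite big1// => j _; rewrite memNset// => -[/mem_set]; rewrite (negPf Ai).
have := sum_rank_le (b := fun i => x \in A i) Ai; rewrite AB => lti.
have := rank_sum (fun j => x \in B j) (\sum_(i' < n | (i' < i)%N) (x \in A i'))%N.
rewrite lti => <-.
apply: eq_bigr => j _; congr nat_of_bool; apply/idP/andP => [/set_mem[]|[Bj /eqP e]].
  by move=> _ /mem_set -> ->.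
by apply/mem_set; split => //; exact: set_mem.
Qed.

Lemma rank_matchC T n m (A : 'I_n -> set T) (B : 'I_m -> set T) i j :
  rank_match A B i j = rank_match B A j i.
Proof. by apply/seteqP; split=> x [? ? ?]; split. Qed.

End Combinatorics.

Lemma near_open {T : topologicalType} (A : set T) x : open A -> A x -> \forall y \near x, A y.
Proof. by move=> oA Ax; apply: open_nbhs_nbhs; split. Qed.

Lemma near_clopen {T : topologicalType} (A : set T) x : clopen A -> \forall y \near x, (y \in A) = (x \in A).
Proof.
move=> [oA cA]; have [Ax|Ax] := boolP (x \in A).
  by apply: filterS (near_open oA (set_mem Ax)) => y /mem_set.
have oAC : open (~` A) by exact: closed_openC.
have nAx : (~` A) x by move=> /mem_set; exact/negP.
by apply: filterS (near_open oAC nAx) => y; exact: memNset.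
Qed.

Lemma near_preimage {T U : topologicalType} (f : T -> U) (A : set U) x :
  {for x, continuous f} -> open A -> A (f x) -> \forall y \near x, A (f y).
Proof. by move=> cf oA Afx; apply: (cf A); exact: near_open. Qed.

Section TopologyFacts.
Context {T U : topologicalType}.

Lemma homeomorphism_on_open (E V : set T) (f : T -> U) :
  open E -> open (f @` E) -> homeomorphism_on E f -> open V -> V `<=` E ->
  open (f @` V).
Proof.
move=> oE ofE [cf [g cg gf]] oV VE.
move: cg; rewrite continuous_open_subspace// => cg.
have -> : f @` V = f @` E `&` g @^-1` V.
  apply/seteqP; split=> [_ [x Vx <-]|_ [[x Ex <-]]].
    by split; [exists x => //; exact: VE|rewrite /= gf//; exact: VE].
  by rewrite /= gf// => Vx; exists x.
by move/(continuous_inP _ ofE): cg; exact.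
Qed.

Lemma homeomorphism_on_inj (E : set T) (f : T -> U) x y :
  homeomorphism_on E f -> E x -> E y -> f x = f y -> x = y.
Proof. by move=> [_ [g _ gf]] Ex Ey e; rewrite -(gf _ Ex) -(gf _ Ey) e. Qed.

Lemma local_homeomorphism_open (f : T -> U) (V : set T) :
  local_homeomorphism f -> open V -> open (f @` V).
Proof.
move=> lf oV; rewrite openE => _ [x Vx <-].
have [W [oW Wx] [ofW hW]] := lf x.
have o : open (f @` (V `&` W)).
  by apply: (homeomorphism_on_open oW ofW hW); [exact: openI|move=> ? []].
have fx : (f @` (V `&` W)) (f x) by exists x.
rewrite /interior; move: (near_open o fx); apply: filterS.
by move=> _ [y [Vy _] <-]; exists y.
Qed.

End TopologyFacts.

Lemma open_injective_homeomorphism_on {T U : topologicalType} (d : U -> T)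
    (E : set T) (f : T -> U) :
  open E -> continuous f -> (forall V, open V -> open (f @` V)) ->
  (forall x y, E x -> E y -> f x = f y -> x = y) -> homeomorphism_on E f.
Proof.
move=> oE cf of_ fI; split; first exact: continuous_subspaceT.
pose g y := if pselect (exists2 x, E x & f x = y) is left h
            then projT1 (cid2 h) else d y.
have gf x : E x -> g (f x) = x.
  move=> Ex; rewrite /g; case: pselect => [h|]; last by case; exists x.
  by case: cid2 => y /= Ey /fI ->.
exists g => //; rewrite continuous_open_subspace; last exact: of_.
move=> _ /set_mem[x Ex <-] W; rewrite /= gf// => Wx.
have [V [oV Vx VW]] : exists V, [/\ open V, V x & V `<=` W].
  by move: Wx; rewrite nbhsE => -[V [? ?] ?]; exists V.
have fx : (f @` (V `&` E)) (f x) by exists x.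
move: (near_open (of_ _ (openI oV oE)) fx); apply: filterS.
by move=> _ [y [Vy Ey] <-] /=; rewrite gf//; exact: VW.
Qed.

Section GroupoidFacts.
Variable G : ampleGroupoid.
Local Notation s := (@gsrc G).
Local Notation r := (@grng G).
Local Notation cob := (@compact_open_bisection G).
Implicit Types E F : set (arrow G).

Lemma gsrc_open (V : set (arrow G)) : open V -> open (s @` V).
Proof. by apply: local_homeomorphism_open; have [] := ample_etale G. Qed.
Lemma grng_open (V : set (arrow G)) : open V -> open (r @` V).
Proof. by apply: local_homeomorphism_open; have [] := ample_etale G. Qed.

Lemma cobP E : cob E <->
  [/\ compact E, open E, forall x y, E x -> E y -> s x = s y -> x = y &
      forall x y, E x -> E y -> r x = r y -> x = y].
Proof.
split=> [[kE oE [_ hs] [_ hr]]|[kE oE sI rI]].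
  by split=> // x y; apply: homeomorphism_on_inj.
split => //; split.
- exact: gsrc_open.
- apply: open_injective_homeomorphism_on => //; [exact: gunit|exact: gsrc_continuous|exact: gsrc_open].
- exact: grng_open.
- apply: open_injective_homeomorphism_on => //; [exact: gunit|exact: grng_continuous|exact: grng_open].
Qed.

Lemma object_hausdorff : hausdorff_space (object G).
Proof.
move=> x y xy; rewrite -(gsrc_unit x) -(gsrc_unit y); congr (s _).
apply: arrow_hausdorff => A B Ax By.
have [z [Az Bz]] := xy _ _ (gunit_continuous Ax) (gunit_continuous By).
by exists (gunit z).
Qed.

Lemma image_clopen (f : arrow G -> object G) E : continuous f ->
  compact E -> open (f @` E) -> clopen (f @` E).
Proof.
move=> cf kE oE; split => //; apply: compact_closed; first exact: object_hausdorff.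
by apply: continuous_compact => //; exact: continuous_subspaceT.
Qed.

Lemma cob_src_clopen E : cob E -> clopen (s @` E).
Proof. by case=> kE _ [? _] _; apply: image_clopen => //; exact: gsrc_continuous. Qed.
Lemma cob_rng_clopen E : cob E -> clopen (r @` E).
Proof. by case=> kE _ _ [? _]; apply: image_clopen => //; exact: grng_continuous. Qed.

Lemma cob_section E : cob E -> exists g : object G -> arrow G,
  (forall x, E x -> g (s x) = x) /\ (forall y, (s @` E) y -> {for y, continuous g}).
Proof.
move=> [_ _ [oE [_ [g cg gs]]] _]; exists g; split => // y yE.
by move: cg; rewrite continuous_open_subspace//; apply; exact: mem_set.
Qed.

Lemma gmul_continuous_at {T : topologicalType} (u v : T -> arrow G) x :
  {for x, continuous u} -> {for x, continuous v} ->
  (\forall y \near x, s (u y) = r (v y)) ->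
  {for x, continuous (fun y => gmul (u y) (v y))}.
Proof.
move=> cu cv uv; have uvx := nbhs_singleton uv.
have /subspace_continuousP/(_ (u x, v x) uvx) := @gmul_continuous G.
move=> cm W /cm; rewrite /= /within /=.
move=> [[P Q] /= [Pu Qv] PQ].
change (\forall y \near x, W (gmul (u y) (v y))); near=> y.
have := PQ (u y, v y); apply => /=; last by near: y.
split; near: y; [exact: cu|exact: cv].
Unshelve. all: by end_near. Qed.

Lemma cob_set0 : cob set0.
Proof. by apply/cobP; split=> //; [exact: compact0|exact: open0]. Qed.

Lemma gunit_open_image (C : set (object G)) : open C -> open (@gunit G @` C).
Proof.
move=> oC; rewrite openE => _ [x Cx <-].
have [_ /(_ (gunit x))/(_ setT (filterT))] := ample_ample G.
move=> [E [/cobP[kE oE sI _]] Ex _].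
have : nbhs (gunit x) (E `&` [set e | E (gunit (s e)) /\ C (s e)]).
  apply: filterI; first exact: near_open.
  have ccu : continuous (fun e : arrow G => gunit (s e)).
    by move=> e; apply: continuous_comp; [exact: gsrc_continuous|exact: gunit_continuous].
  apply: filterI; first by apply: ccu; apply: near_open; rewrite ?gsrc_unit.
  by apply: gsrc_continuous; apply: near_open; rewrite ?gsrc_unit.
apply: filterS => e [Ee [Ue Ce]]; exists (s e) => //.
by apply: sI => //; rewrite gsrc_unit.
Qed.

Lemma gunit_bisection (C : set (object G)) :
  compact C -> open C -> cob (@gunit G @` C).
Proof.
move=> kC oC; apply/cobP; split.
- by apply: continuous_compact => //; apply: continuous_subspaceT; exact: gunit_continuous.
- exact: gunit_open_image.
- by move=> _ _ [x _ <-] [y _ <-]; rewrite !gsrc_unit => ->.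
- by move=> _ _ [x _ <-] [y _ <-]; rewrite !grng_unit => ->.
Qed.

Lemma ginvK : involutive (@ginv G).
Proof.
move=> g; rewrite -(gmul1 (ginv (ginv g))) gsrc_inv grng_inv.
rewrite -gVmul gmulA ?gsrc_inv ?grng_inv// gVmul gsrc_inv.
by rewrite g1mul.
Qed.

Lemma ginv_bisection E : cob E -> cob (@ginv G @` E).
Proof.
move=> /cobP[kE oE sI rI]; apply/cobP; split.
- by apply: continuous_compact => //; apply: continuous_subspaceT; exact: ginv_continuous.
- have -> : @ginv G @` E = @ginv G @^-1` E.
    apply/seteqP; split=> [_ [e Ee <-]|e Ee]; first by rewrite /= ginvK.
    by exists (ginv e) => //; rewrite ginvK.
  by apply: open_comp => // ? _; exact: ginv_continuous.
- by move=> _ _ [x Ex <-] [y Ey <-]; rewrite !gsrc_inv => /(rI _ _ Ex Ey) ->.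
- by move=> _ _ [x Ex <-] [y Ey <-]; rewrite !grng_inv => /(sI _ _ Ex Ey) ->.
Qed.

Definition bisection_mul (F E : set (arrow G)) (C : set (object G)) :=
  [set g | exists e f, [/\ E e, F f, s f = r e, C (r e) & g = gmul f e]].

Lemma gmulK f e : s f = r e -> gmul (gmul f e) (ginv e) = f.
Proof.
move=> fe; rewrite -gmulA ?grng_inv// gmulV -fe; exact: gmul1.
Qed.
Lemma gmulVK f e : s f = s e -> gmul (gmul f (ginv e)) e = f.
Proof.
move=> fe; rewrite -gmulA ?grng_inv ?gsrc_inv// gVmul -fe; exact: gmul1.
Qed.

Lemma bisection_mulP F E C : cob F -> cob E -> clopen C -> cob (bisection_mul F E C).
Proof.
move=> hF hE [oC cC].
have [kE oE sIE rIE] := (cobP E).1 hE; have [kF oF sIF rIF] := (cobP F).1 hF.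
have [gE [gEK gEc]] := cob_section hE; have [gF [gFK gFc]] := cob_section hF.
have [osF csF] := cob_src_clopen hF; have [osE csE] := cob_src_clopen hE.
apply/cobP; split.
- pose K := E `&` r @^-1` (C `&` s @` F).
  have kK : compact K.
    apply: compact_closedI => //; apply: preimage_closed; first by move=> ? _; exact: grng_continuous.
    exact: closedI.
  have -> : bisection_mul F E C = (fun e => gmul (gF (r e)) e) @` K.
    apply/seteqP; split=> [_ [e [f [Ee Ff fe Ce ->]]]|_ [e [Ee [Ce [f Ff fe]]] <-]].
      exists e; first by split=> //; split=> //; exists f.
      by rewrite -fe gFK.
    by exists e, f; split => //; rewrite -fe gFK.
  apply: continuous_compact => //; apply: continuous_in_subspaceT.
  move=> e /set_mem[Ee [Ce sFe]].
  apply: gmul_continuous_at => //.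
    apply: (continuous_comp (f := r)); first exact: grng_continuous.
    exact: gFc.
  have : \forall e' \near e, (s @` F) (r e').
    by apply: (near_preimage (f := r)) => //; exact: grng_continuous.
  by apply: filterS => e' [f Ff fe]; rewrite -fe gFK.
- rewrite openE => _ [e [f [Ee Ff fe Ce ->]]].
  set g0 := gmul f e.
  have sg0 : s g0 = s e by rewrite gsrc_mul.
  have cgE : {for g0, continuous (fun g : arrow G => gE (s g))}.
    apply: continuous_comp; first exact: gsrc_continuous.
    by apply: gEc; rewrite sg0; exists e.
  have nE : \forall g \near g0, (s @` E) (s g).
    apply: (near_preimage (f := s)) => //; first exact: gsrc_continuous.
    by rewrite sg0; exists e.
  have cm : {for g0, continuous (fun g : arrow G => gmul g (ginv (gE (s g))))}.
    apply: gmul_continuous_at; first by [].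
      by apply: continuous_comp => //; exact: ginv_continuous.
    by apply: filterS nE => g [e' Ee' e'g]; rewrite -e'g gEK// grng_inv.
  have nF : \forall g \near g0, F (gmul g (ginv (gE (s g)))).
    by apply: (near_preimage cm) => //; rewrite sg0 gEK// /g0 gmulK.
  have nC : \forall g \near g0, C (r (gE (s g))).
    have : {for g0, continuous (fun g : arrow G => r (gE (s g)))}.
      by apply: continuous_comp => //; exact: grng_continuous.
    by move=> /near_preimage; apply => //; rewrite sg0 gEK.
  rewrite /interior; near=> g.
  have [e' Ee' e'g] : (s @` E) (s g) by near: g.
  have Fg : F (gmul g (ginv (gE (s g)))) by near: g.
  have Cg : C (r (gE (s g))) by near: g.
  move: Fg Cg; rewrite -e'g gEK// => Fg Cg.
  exists e', (gmul g (ginv e')); split => //.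
    by rewrite gsrc_mul ?grng_inv// gsrc_inv.
  by rewrite gmulVK.
- move=> _ _ [e [f [Ee Ff fe _ ->]]] [e' [f' [Ee' Ff' fe' _ ->]]].
  rewrite !gsrc_mul// => /(sIE _ _ Ee Ee') ee'; move: fe'; rewrite -ee' -fe.
  by move=> /(sIF _ _ Ff' Ff) ->.
- move=> _ _ [e [f [Ee Ff fe _ ->]]] [e' [f' [Ee' Ff' fe' _ ->]]].
  rewrite !grng_mul// => /(rIF _ _ Ff Ff') ff'; move: fe'; rewrite -ff' fe.
  by move=> /(rIE _ _ Ee Ee') ->.
Unshelve. all: by end_near. Qed.

End GroupoidFacts.

Section CcFacts.
Variable X : topologicalType.
Implicit Types f g : CcZplus X.

Lemma discrete_continuousP (f : X -> int) :
  continuous (f : X -> discrete_topology int) <->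
  forall x, \forall y \near x, f y = f x.
Proof.
split=> [cf x|cf x W].
  by apply: (cf x [set f x]); exact: (@discrete_set1 (discrete_topology int)).
move=> /nbhs_singleton Wx; change (\forall y \near x, W (f y)).
by apply: filterS (cf x) => y ->.
Qed.

Lemma Cc_near f x : \forall y \near x, f y = f x.
Proof. exact: (discrete_continuousP f).1 (@Cc_continuous _ f) x. Qed.

Fact Cc_add_continuous f g :
  continuous ((fun x => f x + g x) : X -> discrete_topology int).
Proof.
apply/discrete_continuousP => x; near=> y; congr (_ + _); near: y; exact: Cc_near.
Unshelve. all: by end_near. Qed.

Fact Cc_add_compact f g : compact (closure [set x | f x + g x != 0]).
Proof.
apply: (subclosed_compact _ (compactU (@Cc_compact_support _ f) (@Cc_compact_support _ g))).
  exact: closed_closure.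
rewrite -closureU; apply: closureS => x /=; have [/= ->|] := eqVneq (f x) 0.
  by rewrite add0r; right.
by left.
Qed.

Fact Cc_add_ge0 f g x : 0 <= f x + g x.
Proof. by rewrite addr_ge0// Cc_ge0. Qed.

Definition Cc_add f g : CcZplus X :=
  MkCcZplus (@Cc_add_continuous f g) (@Cc_add_compact f g) (Cc_add_ge0 f g).

Fact Cc_zero_continuous : continuous ((fun=> 0) : X -> discrete_topology int).
Proof. exact: cst_continuous. Qed.

Fact Cc_zero_compact : compact (closure [set x : X | (0 : int) != 0]).
Proof.
rewrite (_ : [set x | _] = set0); last by apply/seteqP; split => x //=; rewrite eqxx.
by rewrite closure0; exact: compact0.
Qed.

Definition Cc_zero : CcZplus X :=
  MkCcZplus Cc_zero_continuous Cc_zero_compact (fun=> lexx 0).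

Lemma Cc_bounded f : exists n : nat, forall x, f x <= n%:Z.
Proof.
have /compact_near_coveringP := @Cc_compact_support _ f.
move=> /(_ nat \oo (fun n x => f x <= n%:Z) _).
case=> [x _|N _ HN].
  exists ([set y | f y = f x], [set n | (`|f x| <= n)%N]).
    by split; [exact: Cc_near|exists `|f x|%N].
  move=> [y n] /= [-> hn]; apply: le_trans (ler_norm _) _.
  by rewrite -abszE lez_nat.
exists N => x; have [fx0|fx0] := eqVneq (f x) 0; first by rewrite fx0.
by apply: HN => //=; apply: subset_closure.
Qed.

Lemma Cc_level_bounds f (k : nat) :
  compact [set x | k%:Z < f x] /\ open [set x | k%:Z < f x].
Proof.
have o (P : int -> Prop) : open [set x | P (f x)].
  rewrite openE => x /= Px; rewrite /interior.
  by apply: filterS (Cc_near f x) => y /= ->.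
split; last exact: (o (fun z => k%:Z < z)).
apply: (subclosed_compact _ (@Cc_compact_support _ f)).
  rewrite (_ : [set x | _] = ~` [set x | ~ (k%:Z < f x)]).
    by apply: open_closedC; exact: (o (fun z => ~ (k%:Z < z))).
  by apply/seteqP; split=> x /=; [move=> h; apply|exact: contrapT].
move=> x /= kx; apply: subset_closure => /=; rewrite gt_eqF//.
exact: le_lt_trans kx.
Qed.

Lemma Cc_level_sum f n x : f x <= n%:Z ->
  f x = \sum_(k < n) \1_[set x | (k : nat)%:Z < f x] x.
Proof.
rewrite /indic => fn; have [m fm] : exists m : nat, f x = m%:Z.
  by exists `|f x|%N; rewrite gez0_abs// Cc_ge0.
have -> : \sum_(k < n) (x \in [set x | (k : nat)%:Z < f x])%:R =
    \sum_(k < n) ((k < m)%N)%:R :> int.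
  apply: eq_bigr => k _; congr (_%:R); congr nat_of_bool.
  by apply/idP/idP; rewrite inE/= fm ltz_nat.
rewrite -natr_sum fm natz; congr Posz; rewrite fm lez_nat in fn.
transitivity (\sum_(k < m) 1)%N; first by rewrite sum_nat_const card_ord muln1.
by rewrite (big_ord_widen _ (fun=> 1%N) fn) big_mkcond.
Qed.

End CcFacts.

Section GroupoidEquiv.
Variable G : ampleGroupoid.
Local Notation s := (@gsrc G).
Local Notation r := (@grng G).
Local Notation cob := (@compact_open_bisection G).
Implicit Types f g h : CcZplus (object G).

Lemma groupoid_equiv_fin (I : finType) (E : I -> set (arrow G)) f g :
  (forall i, cob (E i)) ->
  (forall x, f x = \sum_i \1_(s @` E i) x) ->
  (forall x, g x = \sum_i \1_(r @` E i) x) -> groupoid_equiv f g.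
Proof.
move=> hE hf hg; exists #|I|, (E \o enum_val); split=> [i|x|x].
- exact: hE.
- by rewrite hf (reindex (@enum_val I I))//; apply: onW_bij; exact: enum_val_bij.
- by rewrite hg (reindex (@enum_val I I))//; apply: onW_bij; exact: enum_val_bij.
Qed.

Lemma groupoid_equiv_refl f : groupoid_equiv f f.
Proof.
have [n fn] := Cc_bounded f.
exists n, (fun k => @gunit G @` [set x | (k : nat)%:Z < f x]); split.
- by move=> k; have [] := Cc_level_bounds f k; exact: gunit_bisection.
- move=> x; rewrite {1}(Cc_level_sum (fn x)); apply: eq_bigr => k _.
  congr (\1_ _ x); rewrite image_comp (_ : _ \o _ = id) ?image_id//.
  by apply/funext => y /=; rewrite gsrc_unit.
- move=> x; rewrite {1}(Cc_level_sum (fn x)); apply: eq_bigr => k _.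
  congr (\1_ _ x); rewrite image_comp (_ : _ \o _ = id) ?image_id//.
  by apply/funext => y /=; rewrite grng_unit.
Qed.

Lemma groupoid_equiv_sym f g : groupoid_equiv f g -> groupoid_equiv g f.
Proof.
move=> [n [E [hE hf hg]]]; exists n, (fun i => @ginv G @` E i); split.
- by move=> i; exact: ginv_bisection.
- move=> x; rewrite hg; apply: eq_bigr => i _; congr (\1_ _ x).
  rewrite image_comp; congr (_ @` _).
  by apply/funext => y /=; rewrite gsrc_inv.
- move=> x; rewrite hf; apply: eq_bigr => i _; congr (\1_ _ x).
  rewrite image_comp; congr (_ @` _).
  by apply/funext => y /=; rewrite grng_inv.
Qed.

Lemma rank_match_clopen n m (A : 'I_n -> set (object G)) (B : 'I_m -> set (object G)) i j :
  (forall i, clopen (A i)) -> (forall j, clopen (B j)) ->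
  clopen (rank_match A B i j).
Proof.
move=> cA cB.
have lc x : \forall y \near x, rank_match A B i j y <-> rank_match A B i j x.
  have nA : \forall y \near x, forall i, (y \in A i) = (x \in A i).
    by apply: filter_forall => k; exact: near_clopen.
  have nB : \forall y \near x, forall i, (y \in B i) = (x \in B i).
    by apply: filter_forall => k; exact: near_clopen.
  near=> y; have Ay : forall i, (y \in A i) = (x \in A i) by near: y.
  have By : forall i, (y \in B i) = (x \in B i) by near: y.
  rewrite /rank_match /=; under eq_bigr do rewrite Ay.
  under [in X in _ = X]eq_bigr do rewrite By.
  have := Ay i; have := By j; rewrite /in_mem /= /in_set/= => By' Ay'.
  have e1 : A i y <-> A i x by split=> /mem_set; [rewrite Ay|rewrite -Ay]; exact: set_mem.
  have e2 : B j y <-> B j x by split=> /mem_set; [rewrite By|rewrite -By]; exact: set_mem.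
  by split=> -[/e1 ? /e2 ? ?]; split.
split.
  rewrite openE => x Cx; rewrite /interior.
  by apply: filterS (lc x) => y; case=> _; apply.
rewrite -[X in closed X]setCK; apply: open_closedC.
rewrite openE => x Cx; rewrite /interior.
by apply: filterS (lc x) => y; case=> yx _ /yx.
Unshelve. all: by end_near. Qed.

Lemma sum_indic_nat (T : Type) n (A : 'I_n -> set T) x :
  \sum_(i < n) \1_(A i) x = ((\sum_(i < n) (x \in A i))%N)%:R :> int.
Proof. by rewrite natr_sum. Qed.

Lemma groupoid_equiv_trans f g h :
  groupoid_equiv f g -> groupoid_equiv g h -> groupoid_equiv f h.
Proof.
move=> [n [E [hE hf hg]]] [m [F [hF hg' hh]]].
pose A i := r @` E i; pose B j := s @` F j.
have cA i : clopen (A i) by exact: cob_rng_clopen.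
have cB i : clopen (B i) by exact: cob_src_clopen.
have AB x : (\sum_(i < n) (x \in A i) = \sum_(j < m) (x \in B j))%N.
  apply/eqP; rewrite -eqz_nat; apply/eqP.
  by rewrite -!natz -!sum_indic_nat -hg -hg'.
pose C i j := rank_match A B i j.
pose W (p : 'I_n * 'I_m) := bisection_mul (F p.2) (E p.1) (C p.1 p.2).
apply: (@groupoid_equiv_fin ('I_n * 'I_m)%type W).
- by move=> p; apply: bisection_mulP => //; exact: rank_match_clopen.
- move=> x; rewrite hf -(pair_bigA _ (fun i j => \1_(s @` W (i, j)) x)) /=.
  apply: eq_bigr => i _; rewrite sum_indic_nat /indic; congr (_%:R).
  have [_ _ sI _] := (cobP (E i)).1 (hE i).
  have [|nx] := boolP (x \in s @` E i); last first.
    rewrite big1// => j _; rewrite memNset// => -[_ [e [f' [Ee Ff fe _ ->]]]].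
    by rewrite gsrc_mul// => ex; move/negP: nx; apply; apply/mem_set; exists e.
  move=> /set_mem[e Ee ex].
  transitivity (nat_of_bool (r e \in A i)).
    by rewrite mem_set//; exists e.
  rewrite -(rank_match_sum (B := B) i (AB (r e))).
  apply: eq_bigr => j _; congr nat_of_bool; apply/idP/idP => /set_mem.
    move=> Ce; have [_ [f' Ff fe] _] := Ce.
    apply/mem_set; exists (gmul f' e); last by rewrite gsrc_mul.
    by exists e, f'.
  move=> [_ [e' [f' [Ee' Ff fe Ce ->]]]]; rewrite gsrc_mul// -ex => /(sI _ _ Ee' Ee) <-.
  exact: mem_set.
- move=> x; rewrite hh -(pair_bigA _ (fun i j => \1_(r @` W (i, j)) x)) /=.
  rewrite exchange_big /=.
  apply: eq_bigr => j _; rewrite sum_indic_nat /indic; congr (_%:R).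
  have [_ _ _ rI] := (cobP (F j)).1 (hF j).
  have [|nx] := boolP (x \in r @` F j); last first.
    rewrite big1// => i _; rewrite memNset// => -[_ [e [f' [Ee Ff fe _ ->]]]].
    by rewrite grng_mul// => ex; move/negP: nx; apply; apply/mem_set; exists f'.
  move=> /set_mem[e Fe ex].
  transitivity (nat_of_bool (s e \in B j)).
    by rewrite mem_set//; exists e.
  rewrite -(rank_match_sum (B := A) j (esym (AB (s e)))).
  apply: eq_bigr => i _; congr nat_of_bool; rewrite -rank_matchC.
  apply/idP/idP => /set_mem.
    move=> Ce; have [[f' Ef fe] _ _] := Ce.
    apply/mem_set; exists (gmul e f'); last by rewrite grng_mul.
    by exists f', e; split => //=; rewrite fe.
  move=> [_ [e' [f' [Ee' Ff fe Ce ->]]]]; rewrite grng_mul// -ex => /(rI _ _ Ff Fe) <-.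
  by rewrite fe; exact: mem_set.
Qed.

Lemma groupoid_equiv_add f f' g g' : groupoid_equiv f f' ->
  groupoid_equiv g g' -> groupoid_equiv (Cc_add f g) (Cc_add f' g').
Proof.
move=> [n [E [hE hf hf']]] [m [F [hF hg hg']]].
apply: (@groupoid_equiv_fin ('I_n + 'I_m)%type
  (fun i => match i with inl i => E i | inr j => F j end)).
- by case.
- by move=> x; rewrite big_sumType /= hf hg.
- by move=> x; rewrite big_sumType /= hf' hg'.
Qed.

Lemma groupoid_equiv_ext f g : f =1 g -> groupoid_equiv f g.
Proof.
move=> fg; have [n [E [hE hf hf']]] := groupoid_equiv_refl f.
by exists n, E; split => // x; rewrite -fg.
Qed.

Definition groupoid_preMonoid : preMonoid.
refine (@PreMonoid (CcZplus (object G)) (@groupoid_equiv G) (Cc_zero _) (@Cc_add _)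
  groupoid_equiv_refl groupoid_equiv_sym groupoid_equiv_trans groupoid_equiv_add _ _ _).
- by move=> f g h; apply: groupoid_equiv_ext => x; exact: addrA.
- by move=> f g; apply: groupoid_equiv_ext => x; exact: addrC.
- by move=> f; apply: groupoid_equiv_ext => x; exact: add0r.
Defined.

Definition type_semigroup : nmodType := quotient_monoid groupoid_preMonoid.

End GroupoidEquiv.

Record homeo_action (Gamma : groupType) (X : topologicalType) := HomeoAction {
  act :> Gamma -> X -> X;
  act1 : forall x, act 1%g x = x;
  actM : forall t u x, act (t * u)%g x = act t (act u x);
  act_continuous : forall t, continuous (act t)
}.

Lemma totally_disconnected_zero_dimensional (X : topologicalType) :
  compact [set: X] -> hausdorff_space X -> totally_disconnected [set: X] ->
  zero_dimensional X.
Proof.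
move=> kX hX tX x y xy; apply: contrapT => noU.
pose Q := [set z | forall U, clopen U -> U x -> U z].
have Qy : Q y by move=> U cU Ux; apply: contrapT => nUy; apply: noU; exists U.
have Qx : Q x by [].
have cQ : closed Q.
  have -> : Q = \bigcap_(U in [set U | clopen U /\ U x]) U.
    by apply/seteqP; split=> z /=; [move=> Qz U [? ?]; exact: Qz|
      move=> Qz U ? ?; exact: Qz].
  by apply: closed_bigI => U [[]].
suff conQ : connected Q.
  have : connected_component [set: X] x y by exists Q.
  by rewrite tX//= => yx; move: xy; rewrite yx eqxx.
apply: contrapT => /connectedPn[E [E0 QE [sE1 sE2]]].
have EQ b : E b `<=` Q by move=> w Ew; rewrite QE; case: b Ew; [right|left].
have cE b : closed (E b).
  move=> z clz; have : Q z by apply: cQ; exact: closureS (EQ b) _ clz.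
  rewrite QE; case: b clz => clz [] // Ez; exfalso.
    by rewrite -[False]/(set0 z) -sE2; split.
  by rewrite -[False]/(set0 z) -sE1; split.
wlog : E E0 QE sE1 sE2 EQ cE / E false x => [wlg|Ex].
  have := Qx; rewrite QE => -[Ex|Ex]; first exact: (wlg E).
  apply: (wlg (fun b => E (~~ b))) => //.
  - by rewrite setUC.
  - by rewrite setIC.
  - by rewrite setIC.
have [U [oU EU UE]] : exists U : set X,
    [/\ open U, E false `<=` U & closure U `&` E true = set0].
  have nE : set_nbhs (E false) (~` E true).
    move=> z Ez; apply: open_nbhs_nbhs; split; first exact: closed_openC.
    by move=> Ez'; rewrite -[False]/(set0 z) -sE1; split=> //; exact: subset_closure.
  have [V hV VE] := compact_normal hX kX (cE false) nE.
  exists (V°); split; first exact: open_interior.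
    by move=> z Ez; exact: hV.
  apply/seteqP; split=> // z [clz Ez]; apply: (VE z) => //.
  by apply: closureS clz; exact: interior_subset.
pose K := closure U `\` U.
have kK : compact K.
  apply: (subclosed_compact _ kX) => //; apply: closedI; first exact: closed_closure.
  exact: open_closedC.
pose F := filter_from [set D : set X | clopen D /\ D x] id.
have FF : Filter F.
  apply: filter_from_filter; first by exists setT; split => //; exact: clopenT.
  by move=> B C [? ?] [? ?]; exists (B `&` C) => //; split=> //; exact: clopenI.
have PF : ProperFilter F by apply: filter_from_proper => D [_ Dx]; exists x.
have [D [[cD Dx] DK]] : exists D, (clopen D /\ D x) /\ D `&` K = set0.
  move/compact_near_coveringP : kK.
  move=> /(_ _ _ setC (powerset_filter_from_filter PF)) [].
    move=> z [clz nUz]; have nQz : ~ Q z.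
      rewrite QE => -[/EU//|Ez]; rewrite -[False]/(set0 z) -UE; split => //.
    have [C [cC Cx nCz]] : exists C, [/\ clopen C, C x & ~ C z].
      apply: contrapT => h; apply: nQz => C cC Cx.
      by apply: contrapT => nCz; apply: h; exists C.
    exists (~` C, [set W | W `<=` C]); first split.
    - by apply: open_nbhs_nbhs; split => //; apply: closed_openC; case: cC.
    - apply/near_powerset_filter_fromP; first by move=> ? ?; exact: subset_trans.
      by exists C => //; exists C.
    - by case=> i j [? /subsetC]; apply.
  move=> S [SF _ [C SC]] /(_ _ SC) KC.
  have [D [cD Dx] DC] := SF _ SC.
  exists D; split => //; apply/seteqP; split=> // z [Dz Kz].
  by case: (KC z Kz); exact: DC.
have cDU : clopen (D `&` U).
  split; first by apply: openI => //; case: cD.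
  rewrite (_ : _ `&` _ = D `&` closure U); last first.
    apply/seteqP; split=> z [Dz Uz]; split => //; first exact: subset_closure.
    apply: contrapT => nUz; rewrite -[False]/(set0 z) -DK; split => //.
  by apply: closedI; [case: cD|exact: closed_closure].
have [z Ez] := E0 true.
have Qz : Q z by rewrite QE; right.
have [_ Uz] := Qz _ cDU (conj Dx (EU _ Ex)).
by rewrite -[False]/(set0 z) -UE; split=> //; exact: subset_closure.
Qed.

Section TransformationGroupoid.
Variables (Gamma : groupType) (X : topologicalType).
Local Notation GX := (discrete_topology Gamma * X)%type.
Variable alpha : homeo_action Gamma X.
Hypotheses (kX : compact [set: X]) (hX : hausdorff_space X)
  (tX : totally_disconnected [set: X]) (sX : @second_countable GX).

Let tg_src (g : GX) : X := g.2.
Let tg_rng (g : GX) : X := alpha (g.1 : Gamma) g.2.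
Let tg_unit (x : X) : GX := ((1%g : Gamma) : discrete_topology Gamma, x).
Let tg_mul (g h : GX) : GX :=
  (((g.1 : Gamma) * (h.1 : Gamma))%g : discrete_topology Gamma, h.2).
Let tg_inv (g : GX) : GX :=
  ((g.1 : Gamma)^-1%g : discrete_topology Gamma, alpha (g.1 : Gamma) g.2).

Let near_discrete (t : discrete_topology Gamma) (x : X) (P : set X) :
  nbhs x P -> nbhs ((t, x) : GX) ([set t] `*` P).
Proof.
by move=> xP; exists ([set t], P) => //; split => //; exact: discrete_set1.
Qed.

Let slice_open (t : discrete_topology Gamma) (P : set X) :
  open P -> open ([set t] `*` P : set GX).
Proof.
move=> oP; rewrite openE => -[u x] /= [-> Px].
by apply: near_discrete; exact: near_open.
Qed.

Fact tg_rng_continuous : continuous tg_rng.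
Proof.
move=> [t x] W /= /(act_continuous (h := alpha)) Wx.
rewrite nbhs_simpl /=; apply: filterS (near_discrete t Wx).
by move=> [u y] /= [-> ?].
Qed.

Fact tg_unit_continuous : continuous tg_unit.
Proof.
move=> x W [[P Q] /= [P1 Qx] PQ]; rewrite nbhs_simpl /=.
apply: filterS Qx => y Qy; apply: PQ; split => //=.
exact: nbhs_singleton P1.
Qed.

Fact tg_mul_continuous : continuous (fun p : GX * GX => tg_mul p.1 p.2).
Proof.
move=> [[t x] [u y]] W [[P Q] /= [Pt Qy] PQ]; rewrite nbhs_simpl /=.
exists ([set t] `*` setT, [set u] `*` Q) => /=.
  by split; apply: near_discrete => //; exact: filterT.
move=> [[t' x'] [u' y']] /= [[-> _] [-> Qy']]; apply: PQ; split => //=.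
exact: nbhs_singleton Pt.
Qed.

Fact tg_inv_continuous : continuous tg_inv.
Proof.
move=> [t x] W [[P Q] /= [Pt /(act_continuous (h := alpha)) Qx] PQ].
rewrite nbhs_simpl /=; apply: filterS (near_discrete t Qx).
move=> [u y] /= [-> Qy]; apply: PQ; split => //=.
exact: nbhs_singleton Pt.
Qed.

Let slice_compact (t : discrete_topology Gamma) (P : set X) :
  compact P -> compact ([set t] `*` P : set GX).
Proof. by move=> kP; apply: compact_setX => //; exact: compact_set1. Qed.

Fact tg_hausdorff : hausdorff_space GX.
Proof.
move=> [t x] [u y] xy.
have e1 : t = u.
  have [[v z] [/= [-> _] [-> _]]//] := xy ([set t] `*` setT) ([set u] `*` setT)
    (near_discrete t filterT) (near_discrete u filterT).
rewrite -e1; congr (_, _); apply: hX => A B Ax By; rewrite -e1 in xy.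
have [[v z] [/= [_ ?] [_ ?]]] := xy _ _ (near_discrete t Ax) (near_discrete t By).
by exists z.
Qed.

Fact tg_locally_compact : locally_compact [set: GX].
Proof.
move=> [t x] _; exists ([set t] `*` setT).
  rewrite /within /=; apply: filterS (near_discrete t filterT) => y ? _ //.
have k : compact ([set t] `*` setT : set GX) by exact: slice_compact.
by split => //; apply: compact_closed => //; exact: tg_hausdorff.
Qed.

Let actK (t : Gamma) : cancel (alpha t) (alpha (t^-1)%g).
Proof. by move=> x; rewrite -actM mulVg act1. Qed.

Definition transformation_topGroupoid : topGroupoid.
refine (@TopGroupoid GX X tg_src tg_rng tg_unit tg_mul tg_inv
  _ _ _ _ _ _ _ _ _ _ _ _ tg_rng_continuous tg_unit_continuous
  (continuous_subspaceT tg_mul_continuous) tg_inv_continuous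
  tg_locally_compact sX tg_hausdorff).
- by [].
- by move=> x; exact: act1.
- by [].
- by move=> g h gh; rewrite /tg_rng /= actM; congr (alpha _ _).
- by move=> g h k _ _; rewrite /tg_mul /= mulgA.
- by move=> [t x]; rewrite /tg_mul /= mulg1.
- by move=> [t x]; rewrite /tg_mul /= mul1g.
- by [].
- by move=> [t x]; rewrite /tg_rng /tg_src /= actK.
- by move=> [t x]; rewrite /tg_mul /tg_unit /tg_rng /= mulgV.
- by move=> [t x]; rewrite /tg_mul /tg_unit /tg_src /= mulVg.
- by move=> x; exact: cvg_snd.
Defined.

End TransformationGroupoid.

Section TransformationAmple.
Variables (Gamma : groupType) (X : topologicalType).
Local Notation GX := (discrete_topology Gamma * X)%type.
Variable alpha : homeo_action Gamma X.
Hypotheses (kX : compact [set: X]) (hX : hausdorff_space X)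
  (tX : totally_disconnected [set: X]) (sX : @second_countable GX).
Let G := transformation_topGroupoid alpha kX hX sX.

Let actK (t : Gamma) : cancel (alpha t) (alpha (t^-1)%g).
Proof. by move=> x; rewrite -actM mulVg act1. Qed.
Let actVK (t : Gamma) : cancel (alpha (t^-1)%g) (alpha t).
Proof. by move=> x; rewrite -actM mulgV act1. Qed.

Let act_image (t : Gamma) (P : set X) : alpha t @` P = alpha (t^-1)%g @^-1` P.
Proof.
apply/seteqP; split=> [_ [x Px <-]|x Px]; first by rewrite /= actK.
by exists (alpha (t^-1)%g x) => //; rewrite actVK.
Qed.

Let act_open (t : Gamma) (P : set X) : open P -> open (alpha t @` P).
Proof.
by move=> oP; rewrite act_image; apply: open_comp => // x _; exact: act_continuous.
Qed.

Let cvg_slice (t : discrete_topology Gamma) : continuous (fun x : X => (t, x) : GX).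
Proof.
move=> x W [[P Q] /= [Pt Qx] PQ]; rewrite nbhs_simpl /=.
apply: filterS Qx => y Qy; apply: PQ; split => //=.
exact: nbhs_singleton Pt.
Qed.

Let slice_bisection (t : discrete_topology Gamma) (P : set X) :
  clopen P -> @compact_open_bisection G ([set t] `*` P : set GX).
Proof.
move=> [oP cP]; have kP : compact P by exact: subclosed_compact kX _.
have es : @gsrc G @` ([set t] `*` P : set GX) = P.
  apply/seteqP; split=> [_ [[u x] [/= _ Px] <-]//|x Px].
  by exists (t, x).
have er : @grng G @` ([set t] `*` P : set GX) = alpha (t : Gamma) @` P.
  apply/seteqP; split=> [_ [[u x] [/= -> Px] <-]|_ [x Px <-]]; first by exists x.
  by exists (t, x).
split.
- by apply: compact_setX => //; exact: compact_set1.
- rewrite openE => -[u x] /= [-> Px].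
  have := near_open oP Px => Px'.
  by exists ([set t], P) => //; split => //; exact: discrete_set1.
- split; first by rewrite es.
  split; first by apply: continuous_subspaceT; exact: gsrc_continuous.
  exists (fun x : X => (t, x) : GX); first exact: continuous_subspaceT.
  by move=> [u x] [/= -> _].
- split; first by rewrite er; exact: act_open.
  split; first by apply: continuous_subspaceT; exact: grng_continuous.
  exists (fun x : X => (t, alpha (t : Gamma)^-1%g x) : GX).
    apply: continuous_subspaceT => x; apply: (continuous_comp (g := fun x : X => (t, x) : GX)).
      exact: act_continuous.
    exact: cvg_slice.
  by move=> [u x] [/= -> _]; congr (_, _); exact: actK.
Qed.

Fact transformation_etale : etale G.
Proof.
by split=> -[t x]; have [_ oE Es Er] := slice_bisection t (@clopenT X);
  exists ([set t] `*` setT : set GX).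
Qed.

Fact transformation_ample : ample G.
Proof.
split=> [E [_ oE _ _] //|[t x] W [[P Q] /= [Pt Qx] PQ]].
have zX : zero_dimensional X by exact: totally_disconnected_zero_dimensional.
have [D [Dx cD] DQ] := zero_dimensional_cvg hX zX kX Qx.
exists ([set t] `*` D : set GX); first by split => //; exact: slice_bisection.
move=> [u y] [/= -> Dy]; apply: PQ; split => //=; last exact: DQ.
exact: nbhs_singleton Pt.
Qed.

Definition transformation_groupoid : ampleGroupoid :=
  AmpleGroupoid transformation_etale transformation_ample.

End TransformationAmple.

Section ActionTypeSemigroup.
Variables (Gamma : groupType) (X : topologicalType).
Variable alpha : homeo_action Gamma X.
Hypothesis hX : hausdorff_space X.
Local Notation XN := (X * nat)%type.
Local Notation compact_open A := (compact A /\ open A).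

Definition is_disjoint_union {T : Type} {I : Type} (A : set T) (F : I -> set T) :=
  A = \bigcup_(i in [set: I]) F i /\ trivIset [set: I] F.

Definition layers (n : nat) (F : nat -> set X) : set XN :=
  \bigcup_(i in [set i | (1 <= i <= n)%N]) (F i `*` [set i]).

Definition shift (n : nat) (A : set XN) : set XN :=
  [set (p.1, (n + p.2)%N) | p in A].

Definition layered (n : nat) (A : set XN) :=
  exists2 F : nat -> set X,
    (forall i, (1 <= i <= n)%N -> compact_open (F i)) & A = layers n F.

Record rs_set := RsSet {
  rs_carrier :> set XN;
  rs_layered : exists n, layered n rs_carrier
}.

Definition rs_equiv (A B : set XN) : Prop :=
  exists (l : nat) (C : 'I_l -> set X) (t : 'I_l -> Gamma) (n m : 'I_l -> nat),
    [/\ forall k, compact_open (C k),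
        is_disjoint_union A (fun k => C k `*` [set n k]) &
        is_disjoint_union B (fun k => (alpha (t k) @` C k) `*` [set m k])].

Lemma disjoint_unionP {T I} (A : set T) (F : I -> set T) :
  is_disjoint_union A F <->
  [/\ forall i, F i `<=` A, forall x, A x -> exists i, F i x &
      forall x i j, F i x -> F j x -> i = j].
Proof.
split=> [[-> tF]|[FA AF Fij]].
  split=> [i x Fx|x [i _ Fx]|x i j Fi Fj]; [by exists i|by exists i|].
  by apply: tF => //; exists x.
split; last by move=> i j _ _ [x [Fi Fj]]; exact: Fij Fi Fj.
apply/seteqP; split=> [x /AF[i Fx]|x [i _]]; [by exists i|exact: FA].
Qed.

Let actK (t : Gamma) : cancel (alpha t) (alpha (t^-1)%g).
Proof. by move=> x; rewrite -actM mulVg act1. Qed.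
Let actVK (t : Gamma) : cancel (alpha (t^-1)%g) (alpha t).
Proof. by move=> x; rewrite -actM mulgV act1. Qed.

Lemma act_imageE (t : Gamma) (P : set X) :
  alpha t @` P = alpha (t^-1)%g @^-1` P.
Proof.
apply/seteqP; split=> [_ [x Px <-]|x Px]; first by rewrite /= actK.
by exists (alpha (t^-1)%g x) => //; rewrite actVK.
Qed.

Lemma act_compact_open (t : Gamma) (P : set X) :
  compact_open P -> compact_open (alpha t @` P).
Proof.
move=> [kP oP]; split.
  by apply: continuous_compact => //; apply: continuous_subspaceT; exact: act_continuous.
by rewrite act_imageE; apply: open_comp => // x _; exact: act_continuous.
Qed.

Lemma compact_openI (P Q : set X) :
  compact_open P -> compact_open Q -> compact_open (P `&` Q).
Proof.
move=> [kP oP] [kQ oQ]; split; last exact: openI.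
by apply: compact_closedI => //; exact: compact_closed.
Qed.

Lemma rs_equiv_fin (I : finType) (C : I -> set X) (t : I -> Gamma)
    (n m : I -> nat) A B :
  (forall k, compact_open (C k)) ->
  is_disjoint_union A (fun k => C k `*` [set n k]) ->
  is_disjoint_union B (fun k => (alpha (t k) @` C k) `*` [set m k]) ->
  rs_equiv A B.
Proof.
move=> hC hA hB; pose e := @enum_val I I.
have re (T : Type) (S : set T) (F : I -> set T) :
    is_disjoint_union S F -> is_disjoint_union S (F \o e).
  move=> /disjoint_unionP[FS SF Fij]; apply/disjoint_unionP; split.
  - by move=> i; exact: FS.
  - by move=> x /SF[i Fi]; exists (enum_rank i); rewrite /e /= enum_rankK.
  - by move=> x i j /Fij h /h; exact: enum_val_inj.
exists #|I|, (C \o e), (t \o e), (n \o e), (m \o e); split.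
- by move=> k; exact: hC.
- exact: re hA.
- exact: re hB.
Qed.

Lemma rs_equiv_refl n A : layered n A -> rs_equiv A A.
Proof.
move=> [F hF ->]; have hF' (i : 'I_n) : compact_open (F i.+1).
  by apply: hF => /=; exact: ltn_ord.
apply: (@rs_equiv_fin _ (fun i : 'I_n => F i.+1) (fun=> 1%g) (fun i => i.+1)
  (fun i => i.+1)) => //.
  apply/disjoint_unionP; split=> [i x Fx|[x k] [i /= /andP[i0 il] [/= Fx ->]]|].
  - by exists i.+1 => //=; exact: ltn_ord.
  - by case: i i0 il Fx => // i _ il Fx; exists (Ordinal il).
  - by move=> [x k] i j [/= _ ->] [/= _ /succn_inj/val_inj].
have -> : (fun i : 'I_n => (alpha 1%g @` F i.+1) `*` [set i.+1]) =
    (fun i : 'I_n => F i.+1 `*` [set i.+1]).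
  apply/funext => i; congr (_ `*` _).
  by rewrite (_ : (alpha 1%g : X -> X) = id) ?image_id//; apply/funext => x; exact: act1.
apply/disjoint_unionP; split=> [i x Fx|[x k] [i /= /andP[i0 il] [/= Fx ->]]|].
- by exists i.+1 => //=; exact: ltn_ord.
- by case: i i0 il Fx => // i _ il Fx; exists (Ordinal il).
- by move=> [x k] i j [/= _ ->] [/= _ /succn_inj/val_inj].
Qed.

Lemma rs_equiv_sym A B : rs_equiv A B -> rs_equiv B A.
Proof.
move=> [l [C [t [n [m [hC hA hB]]]]]].
exists l, (fun k => alpha (t k) @` C k), (fun k => (t k)^-1%g), m, n; split => //.
  by move=> k; exact: act_compact_open.
have -> : (fun k => [set alpha (t k)^-1%g x | x in alpha (t k) @` C k] `*` [set n k]) =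
    (fun k => C k `*` [set n k]) => //.
apply/funext => k; congr (_ `*` _); rewrite image_comp.
by rewrite (_ : _ \o _ = id) ?image_id//; apply/funext => x /=; rewrite actK.
Qed.

Lemma rs_equiv_trans A B D : rs_equiv A B -> rs_equiv B D -> rs_equiv A D.
Proof.
move=> [l [C [t [n [m [hC hA hB]]]]]] [l' [C' [t' [n' [m' [hC' hB' hD]]]]]].
move/disjoint_unionP : hA => [CA AC Cij]; move/disjoint_unionP : hB => [CB BC Cij'].
move/disjoint_unionP : hB' => [DB BD Dij]; move/disjoint_unionP : hD => [DD DC Dij'].
pose E (p : 'I_l * 'I_l') :=
  if m p.1 == n' p.2 then C p.1 `&` alpha (t p.1)^-1%g @` C' p.2 else set0.
have EP p x : E p x <-> [/\ m p.1 = n' p.2, C p.1 x & C' p.2 (alpha (t p.1) x)].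
  rewrite /E; case: eqP => [e|ne]; last by split=> // -[].
  split=> [[Cx [y C'y yx]]|[_ Cx C'x]].
    by split=> //; rewrite -yx actVK.
  by split=> //; exists (alpha (t p.1) x) => //; rewrite actK.
apply: (@rs_equiv_fin ('I_l * 'I_l')%type E (fun p => t' p.2 * t p.1)%g
  (fun p => n p.1) (fun p => m' p.2)).
- move=> p; rewrite /E; case: eqP => _.
    by apply: compact_openI => //; exact: act_compact_open.
  by split; [exact: compact0|exact: open0].
- apply/disjoint_unionP; split.
  + by move=> p [x k] [/= /EP[_ Cx _] ->]; exact: (CA p.1 (x, n p.1)).
  + move=> [x k] /AC[i [/= Cx ->]].
    have /BD[j [/= C'x e]] : B (alpha (t i) x, m i).
      by apply: (CB i); split => //; exists x.
    by exists (i, j); split => //=; apply/EP; split.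
  + move=> [x k] [i j] [i' j'] [/= /EP/= [e Cx C'x] kn] [/= /EP/= [e' Cx' C'x'] kn'].
    have ii' : i = i' by apply: (Cij (x, k)); split.
    move: e' C'x'; rewrite -ii' => e' C'x'; congr (_, _).
    by apply: (Dij (alpha (t i) x, m i)); split.
- apply/disjoint_unionP; split.
  + move=> p [_ k] [/= [x /EP[_ _ C'x] <-] ->].
    apply: (DD p.2); split => //=; exists (alpha (t p.1) x) => //.
    by rewrite actM.
  + move=> [y k] /DC[j [/= [z C'z <-] ->]].
    have /BC[i [/= [x Cx xz] e]] : B (z, n' j) by apply: (DB j); split.
    exists (i, j); split => //=; exists x; last by rewrite actM xz.
    by apply/EP; split => //=; rewrite xz.
  + move=> [y k] [i j] [i' j'].
    move=> [/= [x /EP/= [e Cx C'x] xy] kn] [/= [x' /EP/= [e' Cx' C'x'] xy'] kn'].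
    rewrite actM in xy; rewrite actM in xy'.
    have jj' : j = j'.
      by apply: (Dij' (y, k)); split => //=; [exists (alpha (t i) x)|exists (alpha (t i') x')].
    have tt : alpha (t i) x = alpha (t i') x'.
      move: xy'; rewrite -xy -jj' => /(congr1 (alpha (t' j)^-1%g)).
      by rewrite !actK.
    congr (_, _) => //; apply: (Cij' (alpha (t i) x, m i)); split => //=.
      by exists x.
    * by rewrite tt; exists x'.
    * by rewrite e e' jj'.
Qed.

Lemma shiftP n A x k : shift n A (x, k) <-> exists2 j, A (x, j) & k = (n + j)%N.
Proof.
split=> [[[y j] Ay [<- <-]]|[j Aj ->]]; first by exists j.
by exists (x, j).
Qed.

(* the shifts are arbitrary as long as they separate the two summands *)
Lemma rs_equiv_union A A' B B' a a' b b' :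
  shift a A `&` shift b B = set0 -> shift a' A' `&` shift b' B' = set0 ->
  rs_equiv A A' -> rs_equiv B B' ->
  rs_equiv (shift a A `|` shift b B) (shift a' A' `|` shift b' B').
Proof.
move=> AB AB' [l [C [t [n [m [hC hA hA']]]]]] [l' [C' [t' [n' [m' [hC' hB hB']]]]]].
have U (I J : Type) (S T : set XN) (p q : nat) (F : I -> set X) (H : J -> set X)
    (u : I -> nat) (v : J -> nat) :
    shift p S `&` shift q T = set0 ->
    is_disjoint_union S (fun i => F i `*` [set u i]) ->
    is_disjoint_union T (fun i => H i `*` [set v i]) ->
    is_disjoint_union (shift p S `|` shift q T) (fun k : I + J =>
      match k with inl i => F i `*` [set (p + u i)%N]
                 | inr j => H j `*` [set (q + v j)%N] end).
  move=> ST0 /disjoint_unionP[FS SF Fij] /disjoint_unionP[HT TH Hij].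
  apply/disjoint_unionP; split.
  - move=> [i|j] [x k] [/= Fx ->]; [left|right]; apply/shiftP.
      by exists (u i) => //; exact: (FS i).
    by exists (v j) => //; exact: (HT j).
  - move=> [x k] [] /shiftP[w].
      by move=> /SF[i [/= Fx ->]] ->; exists (inl i).
    by move=> /TH[i [/= Fx ->]] ->; exists (inr i).
  - have sep x k i j : (F i `*` [set (p + u i)%N]) (x, k) ->
        (H j `*` [set (q + v j)%N]) (x, k) -> False.
      move=> [/= Fx ki] [/= Hx kj]; rewrite -[False]/(set0 (x, k)) -ST0; split.
        by apply/shiftP; exists (u i) => //; exact: (FS i).
      by apply/shiftP; exists (v j) => //; exact: (HT j).
    move=> [x k] [i|j] [i'|j'] h h'.
    + congr inl; case: h h' => /= Fx -> [/= Fx' /addnI e].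
      by apply: (Fij (x, u i)); split.
    + by case: (sep _ _ _ _ h h').
    + by case: (sep _ _ _ _ h' h).
    + congr inr; case: h h' => /= Fx -> [/= Fx' /addnI e].
      by apply: (Hij (x, v j)); split.
pose CC (k : 'I_l + 'I_l') := match k with inl i => C i | inr j => C' j end.
pose tt (k : 'I_l + 'I_l') := match k with inl i => t i | inr j => t' j end.
apply: (@rs_equiv_fin ('I_l + 'I_l')%type CC tt
  (fun k => match k with inl i => a + n i | inr j => b + n' j end)%N
  (fun k => match k with inl i => a' + m i | inr j => b' + m' j end)%N).
- by case.
- have := U _ _ _ _ _ _ _ _ _ _ AB hA hB.
  by congr is_disjoint_union; apply/funext; case.
- have := U _ _ _ _ _ _ _ _ _ _ AB' hA' hB'.
  by congr is_disjoint_union; apply/funext; case.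
Qed.

Lemma shift0 A : shift 0 A = A.
Proof.
apply/seteqP; split=> -[x k]; first by move=> /shiftP[j Aj ->].
by move=> Ak; apply/shiftP; exists k.
Qed.

Lemma shiftD n m A : shift n (shift m A) = shift (n + m) A.
Proof.
apply/seteqP; split=> -[x k] /shiftP[j].
  by move=> /shiftP[i Ai ->] ->; apply/shiftP; exists i => //; rewrite addnA.
move=> Aj ->; apply/shiftP; exists (m + j)%N; last by rewrite addnA.
by apply/shiftP; exists j.
Qed.

Lemma shiftU n A B : shift n (A `|` B) = shift n A `|` shift n B.
Proof. exact: image_setU. Qed.

Lemma layered_level n A x k : layered n A -> A (x, k) -> (1 <= k <= n)%N.
Proof. by move=> [F _ ->] [i /= ? [/= _ ->]]. Qed.

Lemma layered_shift_disjoint n m A B :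
  layered n A -> layered m B -> A `&` shift n B = set0.
Proof.
move=> hA hB; apply/seteqP; split=> // -[x k] [/(layered_level hA)/andP[_ kn]].
move=> /shiftP[j /(layered_level hB)/andP[j1 _] e].
by move: kn; rewrite e -{2}[n]addn0 leq_add2l leqNgt j1.
Qed.

Lemma layeredU n m A B :
  layered n A -> layered m B -> layered (n + m) (A `|` shift n B).
Proof.
move=> [F hF ->] [H hH ->].
exists (fun i => if (i <= n)%N then F i else H (i - n)%N).
  move=> i /andP[i1 im]; case: leqP => [le|lt]; first by apply: hF; rewrite i1.
  by apply: hH; rewrite subn_gt0 lt leq_subLR.
apply/seteqP; split=> -[x k].
  case=> [[i /= /andP[i1 il] [/= Fx ->]]|/shiftP[j [i /= /andP[i1 il] [/= Hx ->]] ->]].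
    by exists i => //=; [rewrite i1 (leq_trans il)// leq_addr|rewrite il].
  exists (n + i)%N => //=; first by rewrite leq_add2l il addn_gt0 i1 orbT.
  by rewrite -{2}[n]addn0 leq_add2l leqNgt i1 /= addKn.
move=> [i /= /andP[i1 il] []] /=; case: leqP => [le|lt] Fx ->.
  by left; exists i => //=; rewrite i1.
right; apply/shiftP; exists (i - n)%N; last by rewrite subnKC// ltnW.
by exists (i - n)%N => //=; rewrite subn_gt0 lt leq_subLR.
Qed.

(* A number of layers is chosen to place the second summand of a sum; the
   class of the sum does not depend on it, see [rs_addE]. *)
Definition rs_level (A : rs_set) : nat := projT1 (cid (rs_layered A)).

Lemma rs_levelP A : layered (rs_level A) A.
Proof. exact: projT2 (cid (rs_layered A)). Qed.

Definition rs_mk n A (hA : layered n A) : rs_set :=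
  @RsSet A (ex_intro _ n hA).

Definition rs_layers n (F : nat -> set X)
    (hF : forall i, (1 <= i <= n)%N -> compact_open (F i)) : rs_set :=
  @rs_mk n (layers n F) (ex_intro2 _ _ F hF erefl).

Definition rs_add (A B : rs_set) : rs_set :=
  rs_mk (layeredU (rs_levelP A) (rs_levelP B)).

Fact layered_set0 : layered 0 (set0 : set XN).
Proof.
exists (fun=> set0); first by case.
by apply/seteqP; split=> // x [i /= /andP[i1 /(leq_trans i1)]].
Qed.

Definition rs_zero : rs_set := rs_mk layered_set0.

Let refl (A : rs_set) : rs_equiv A A := rs_equiv_refl (rs_levelP A).

Lemma rs_add_level (A A' B B' : rs_set) n : layered n A' ->
  rs_equiv A A' -> rs_equiv B B' -> rs_equiv (rs_add A B) (A' `|` shift n B').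
Proof.
move=> hA' AA' BB' /=; rewrite -[X in X `|` _]shift0 -[X in _ (X `|` _)]shift0.
apply: rs_equiv_union => //; rewrite shift0.
  exact: layered_shift_disjoint (rs_levelP A) (rs_levelP B).
exact: layered_shift_disjoint hA' (rs_levelP B').
Qed.

Definition rs_preMonoid : preMonoid.
refine (@PreMonoid rs_set (fun A B => rs_equiv A B) rs_zero rs_add refl
  (fun A B => @rs_equiv_sym A B) (fun A B D => @rs_equiv_trans A B D) _ _ _ _).
- move=> A A' B B' AA' BB'; exact: rs_add_level (rs_levelP A') AA' BB'.
- move=> A B D; apply: rs_equiv_sym; apply: rs_equiv_trans.
    exact: (rs_add_level (A' := rs_add A B) (layeredU (rs_levelP A) (rs_levelP B)) (refl _) (refl D)).
  have -> : (rs_add A B `|` shift (rs_level A + rs_level B) D) =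
    A `|` shift (rs_level A) (rs_add B D).
    by rewrite /= shiftU shiftD setUA.
  exact: refl (rs_add A (rs_add B D)).
- move=> A B /=; rewrite -[X in X `|` _]shift0 -[X in _ (X `|` _)]shift0.
  rewrite [X in rs_equiv _ X]setUC; apply: rs_equiv_union => //.
    by rewrite shift0; exact: layered_shift_disjoint (rs_levelP A) (rs_levelP B).
  by rewrite shift0 setIC; exact: layered_shift_disjoint (rs_levelP B) (rs_levelP A).
- move=> A; apply: rs_equiv_sym; rewrite /= set0U.
  rewrite -[X in rs_equiv X _]shift0 -[X in rs_equiv X _]setU0.
  rewrite -(setU0 (shift (rs_level rs_zero) A)).
  have s0 : shift 0 set0 = set0 by exact: shift0.
  rewrite -s0; apply: rs_equiv_union; rewrite ?s0 ?setI0//.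
  exact: rs_equiv_refl layered_set0.
Defined.

Definition action_type_semigroup : nmodType := quotient_monoid rs_preMonoid.

Definition rs_class (A : rs_set) : action_type_semigroup :=
  @qclass rs_preMonoid A.

Lemma rs_addE n F hF m H hH (D : rs_set) :
  (D : set XN) = layers n F `|` shift n (layers m H) ->
  rs_class (@rs_layers n F hF) + rs_class (@rs_layers m H hH) = rs_class D.
Proof.
move=> DE; rewrite [LHS]qaddE; apply/qclassP; rewrite /pm_eqv /= DE.
apply: (@rs_add_level (@rs_layers n F hF) (@rs_layers n F hF)
  (@rs_layers m H hH) (@rs_layers m H hH)) => //.
by exists F.
Qed.

End ActionTypeSemigroup.

(* Main.v *)
Require Import Defs.
From mathcomp Require Import all_boot all_algebra.
From mathcomp Require Import all_classical topology.
From mathcomp Require Import numfun.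

(** A layered set [A] in [X * nat] is sent to the function counting, at each
    point [x], the [k] with [(x, k)] in [A].  If [A] is the disjoint union of
    the [C_i x {n_i}], then the count of [A] is the sum of the indicators of
    the [C_i], whatever the levels [n_i] are ([rs_countE]).  Hence counting
    is additive, and it reaches every [f] in C_c(X, Z)^+, which is the sum of
    the indicators of its superlevel sets [k < f] ([rs_count_surj]).

    The heart of the proof is that [A ~ B] if and only if the counts of [A]
    and [B] are equivalent for the groupoid ([rs_equiv_count]).  A family
    [(C_k, t_k, n_k, m_k)] witnessing [A ~ B] gives the bisections
    [{t_k} x C_k], with sources [C_k] and ranges [t_k.C_k].  Conversely, a
    compact open bisection meets finitely many of the slices [{t} x X], so it
    is a finite disjoint union of bisections [{t} x C]
    ([bisection_decomposition]).  The counts of [A] and [B] are then the sums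
    of the indicators of the [C_k] and of the [t_k.C_k], and [A] and [B] are
    linked through the disjoint unions of the [C_k x {k}] and of the
    [t_k.C_k x {k}]: two sets with the same count are equivalent through
    translations by the neutral element ([rs_equiv_indic_sum]), because two
    families of clopen sets with the same sum of indicators have a common
    clopen refinement, which matches, at each point, the [r]-th sets of the
    two families containing it.

    Counting thus induces an isomorphism from S(X, Gamma) onto S(G), and the
    inverse is the required map.  An additive bijection preserves and reflects
    the algebraic preorder. *)

Set Implicit Arguments.
Unset Strict Implicit.
Unset Printing Implicit Defensive.
Import GRing.Theory Num.Theory.
Local Open Scope classical_set_scope.
Local Open Scope ring_scope.

(** * Isomorphisms of quotient monoids *)

Lemma preordered_monoid_iso_additive (M N : nmodType) (phi : M -> N) :
  bijective phi -> phi 0 = 0 -> {morph phi : x y / x + y} ->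
  preordered_monoid_iso phi.
Proof.
move=> bphi phi0 phiD; split => // x y.
have [psi phiK psiK] := bphi.
split=> [[z <-]|[z e]]; first by exists (phi z); rewrite phiD.
by exists (psi z); apply: (can_inj phiK); rewrite phiD psiK.
Qed.

Lemma preordered_monoid_iso_inv (M N : nmodType) (phi : M -> N) :
  preordered_monoid_iso phi -> exists psi : N -> M, preordered_monoid_iso psi.
Proof.
move=> [[psi phiK psiK] phi0 phiD _]; exists psi.
apply: preordered_monoid_iso_additive; first by exists phi.
- by rewrite -phi0 phiK.
- by move=> x y; apply: (can_inj phiK); rewrite phiD !psiK.
Qed.

(** An additive map that preserves and reflects the equivalences, and is onto
    up to equivalence, induces an isomorphism of the quotient monoids. *)
Lemma quotient_monoid_iso (P Q : preMonoid) (F : pm_sort P -> pm_sort Q) :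
  (forall x y, pm_eqv x y <-> pm_eqv (F x) (F y)) ->
  (forall y, exists x, pm_eqv (F x) y) ->
  pm_eqv (F (pm_zero P)) (pm_zero Q) ->
  (forall x y, pm_eqv (F (pm_add x y)) (pm_add (F x) (F y))) ->
  exists phi : quotient_monoid P -> quotient_monoid Q,
    preordered_monoid_iso phi.
Proof.
move=> Feqv Fsurj F0 FD.
pose phi (a : quotient_monoid P) := qclass (F (qrepr a)).
have phiE x : phi (qclass x) = qclass (F x).
  by apply/qclassP/Feqv/qclassP; rewrite qreprK.
have phi_inj : injective phi.
  move=> a b /qclassP/Feqv/qclassP; by rewrite !qreprK.
have phi_surj b : exists a, phi a = b.
  have [x xb] := Fsurj (qrepr b); exists (qclass x).
  by rewrite phiE -[RHS]qreprK; exact/qclassP.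
exists phi; apply: preordered_monoid_iso_additive.
- pose psi b := projT1 (cid (phi_surj b)).
  have psiK : cancel psi phi by move=> b; exact: projT2 (cid (phi_surj b)).
  by exists psi => // a; apply: phi_inj; rewrite psiK.
- by rewrite [LHS]phiE; exact/qclassP.
- move=> a b; rewrite -(qreprK a) -(qreprK b) [qclass _ + _]qaddE !phiE.
  by rewrite [RHS]qaddE; exact/qclassP.
Qed.

(** * Disjoint unions and sums of indicators *)

Section DisjointUnions.

Lemma indic_disjoint_union (T : Type) (I : finType) (A : set T)
    (F : I -> set T) x :
  is_disjoint_union A F -> \1_A x = \sum_i \1_(F i) x :> int.
Proof.
move=> /disjoint_unionP[FA AF Fij]; rewrite indicE.
have [/set_mem Ax|nAx] := boolP (x \in A).
  have [i Fi] := AF _ Ax; rewrite (bigD1 i)//= indicE mem_set// big1 ?addr0//.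
  move=> j /eqP ji; rewrite indicE memNset// => Fj.
  by apply: ji; exact: Fij Fj Fi.
rewrite big1// => i _; rewrite indicE memNset// => /FA Ax.
by rewrite mem_set in nAx.
Qed.

(** If two finite families have the same sum of indicators, the pieces of
    their common refinement that lie in [A i] partition [A i]. *)
Lemma rank_match_disjoint_union (T : Type) n m (A : 'I_n -> set T)
    (B : 'I_m -> set T) (i : 'I_n) :
  (forall x, \sum_i \1_(A i) x = \sum_j \1_(B j) x :> int) ->
  is_disjoint_union (A i) (rank_match A B i).
Proof.
move=> AB.
have S x : (\sum_(j < m) (x \in rank_match A B i j) = (x \in A i))%N.
  apply: rank_match_sum; apply/eqP; rewrite -eqz_nat -!natz -!sum_indic_nat.
  by rewrite AB.
apply/disjoint_unionP; split=> [j x []//|x Ax|x j k Rj Rk].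
  apply: contrapT => nR; have := S x; rewrite (mem_set Ax) big1// => j _.
  by rewrite memNset// => Rj; apply: nR; exists j.
apply/eqP; apply: contraT => jk; have := S x.
rewrite (bigD1 j)//= (bigD1 k) 1?eq_sym//= !mem_set//.
by case: Rj.
Qed.

End DisjointUnions.

(** * Counting the levels of a layered set *)

Section TransformationTypeSemigroup.
Variables (Gamma : groupType) (X : topologicalType).
Local Notation GX := (discrete_topology Gamma * X)%type.
Local Notation XN := (X * nat)%type.
Local Notation compact_open A := (compact A /\ open A).
Variable alpha : homeo_action Gamma X.
Hypotheses (kX : compact [set: X]) (hX : hausdorff_space X)
  (tX : totally_disconnected [set: X]) (sX : @second_countable GX).
Local Notation G := (transformation_groupoid alpha kX hX tX sX).

Lemma compact_open_clopen (C : set X) : compact_open C <-> clopen C.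
Proof.
split=> [[kC oC]|[oC cC]]; split=> //; first exact: compact_closed.
exact: subclosed_compact kX _.
Qed.

(** Sets with the same count are equivalent; only the neutral element of the
    group is used, to move the pieces of the common refinement from the levels
    [u] to the levels [v]. *)
Lemma rs_equiv_indic_sum n m (C : 'I_n -> set X) (D : 'I_m -> set X)
    (u : 'I_n -> nat) (v : 'I_m -> nat) (A B : set XN) :
  (forall i, compact_open (C i)) -> (forall j, compact_open (D j)) ->
  is_disjoint_union A (fun i => C i `*` [set u i]) ->
  is_disjoint_union B (fun j => D j `*` [set v j]) ->
  (forall x, \sum_i \1_(C i) x = \sum_j \1_(D j) x :> int) ->
  rs_equiv alpha A B.
Proof.
move=> hC hD hA hB CD.
have a1 : alpha 1%g = id :> (X -> X) by apply/funext => x; exact: act1.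
have RC i := rank_match_disjoint_union i CD.
have RD j := rank_match_disjoint_union j (fun x => esym (CD x)).
move: hA hB => /disjoint_unionP[CA AC Cij] /disjoint_unionP[DB BD Dij].
apply: (@rs_equiv_fin _ _ alpha ('I_n * 'I_m)%type
  (fun p => rank_match C D p.1 p.2) (fun=> 1%g)
  (fun p => u p.1) (fun p => v p.2)).
- move=> p; apply/compact_open_clopen.
  by apply: (@rank_match_clopen G) => k; apply/compact_open_clopen.
- apply/disjoint_unionP; split.
  + by move=> p [x k] [/= [Cx _ _] ->]; apply: (CA p.1); split.
  + move=> [x k] /AC[i [/= Cx ->]].
    have /disjoint_unionP[_ /(_ _ Cx)[j Rj] _] := RC i.
    by exists (i, j).
  + move=> [x k] [i j] [i' j'] [/= R uk] [/= R' uk'].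
    have ii' : i = i'.
      by apply: (Cij (x, k)); split => //=; [case: R|case: R'].
    rewrite -ii' in R' *; congr (_, _).
    by have /disjoint_unionP[_ _ h] := RC i; exact: h R R'.
- rewrite (_ : (fun _ => _) = (fun p => rank_match C D p.1 p.2 `*` [set v p.2])).
    apply/disjoint_unionP; split.
    + by move=> p [x k] [/= [_ Dx _] ->]; apply: (DB p.2); split.
    + move=> [x k] /BD[j [/= Dx ->]].
      have /disjoint_unionP[_ /(_ _ Dx)[i Ri] _] := RD j.
      by exists (i, j); split => //=; rewrite rank_matchC.
    + move=> [x k] [i j] [i' j'] [/= R vk] [/= R' vk'].
      have jj' : j = j'.
        by apply: (Dij (x, k)); split => //=; [case: R|case: R'].
      rewrite -jj' rank_matchC in R' *; rewrite rank_matchC in R.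
      congr (_, _).
      by have /disjoint_unionP[_ _ h] := RD j; exact: h R R'.
  by apply/funext => p; rewrite a1 image_id.
Qed.

(** The [k]-th level of [A]. *)
Definition fibre (A : set XN) (k : nat) : set X := [set y | A (y, k)].

(** The number of levels among 1, ..., [n] at which [x] occurs in [A]; for a
    set with [n] layers these are all the levels. *)
Definition fibre_count (n : nat) (A : set XN) (x : X) : int :=
  \sum_(k < n) \1_(fibre A k.+1) x.

Lemma layers_disjoint_union n (F : nat -> set X) :
  is_disjoint_union (layers n F) (fun i : 'I_n => F i.+1 `*` [set i.+1]).
Proof.
apply/disjoint_unionP; split=> [i x Fx|[x k] [i /= /andP[i0 il] [/= Fx ->]]|].
- by exists i.+1 => //=; exact: ltn_ord.
- by case: i i0 il Fx => // i _ il Fx; exists (Ordinal il).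
- by move=> [x k] i j [/= _ ->] [/= _ /succn_inj/val_inj].
Qed.

Lemma layered_disjoint_union n (A : set XN) : layered n A ->
  is_disjoint_union A
    (fun k : 'I_n => fibre A k.+1 `*` [set k.+1]).
Proof.
move=> hA; apply/disjoint_unionP; split.
- by move=> k [x j] [/= Ax ->].
- move=> [x k] Ax; have /andP[] := layered_level hA Ax.
  by case: k Ax => // k Ax _ kn; exists (Ordinal kn).
- by move=> [x k] i j [/= _ ->] [/= _ /succn_inj/val_inj].
Qed.

(** The count does not depend on [n], nor on the levels of the pieces of a
    disjoint union. *)
Lemma fibre_countE n (A : set XN) (I : finType) (C : I -> set X)
    (u : I -> nat) x :
  layered n A -> is_disjoint_union A (fun i => C i `*` [set u i]) ->
  fibre_count n A x = \sum_i \1_(C i) x.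
Proof.
move=> hA dA; have [CA _ _] := (disjoint_unionP _ _).1 dA.
(* Count the pairs of a level [k] and a piece [i] with [x] in [C i] and
   [u i = k.+1]: the sum over [i] first gives the left-hand side. *)
transitivity (\sum_(k < n) \sum_i \1_(C i `*` [set u i]) (x, k.+1) : int).
  by apply: eq_bigr => k _; rewrite -(indic_disjoint_union _ dA) !indicE.
rewrite exchange_big; apply: eq_bigr => i _.
rewrite (@indic_disjoint_union _ 'I_n (C i)
  (fun k => [set y | (C i `*` [set u i]) (y, k.+1)])).
  by apply: eq_bigr => k _; rewrite !indicE.
apply/disjoint_unionP; split=> [k y []//|y Cy|y k l [/= _ <-] [/= _]].
  have /(layered_level hA) : A (y, u i) by apply: (CA i); split.
  case: (u i) (erefl (u i)) => // k uk /andP[_ kn].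
  by exists (Ordinal kn); split.
by move=> /succn_inj/val_inj.
Qed.

Lemma layered_fibre n (A : set XN) (k : 'I_n) : layered n A ->
  compact_open (fibre A k.+1).
Proof.
move=> [F hF ->].
rewrite (_ : fibre _ _ = F k.+1); first by apply: hF; exact: ltn_ord.
apply/seteqP; split=> y /=; first by move=> [i _ [/= Fy ->]].
by move=> Fy; exists k.+1 => //=; exact: ltn_ord.
Qed.

Fact fibre_count_continuous n (A : set XN) : layered n A ->
  continuous (fibre_count n A : X -> discrete_topology int).
Proof.
move=> hA; apply/discrete_continuousP => x.
have nA : \forall y \near x, forall k : 'I_n,
    (y \in fibre A k.+1) = (x \in fibre A k.+1).
  apply: filter_forall => k; apply: near_clopen; apply/compact_open_clopen.
  exact: layered_fibre.
by apply: filterS nA => y yx; apply: eq_bigr => k _; rewrite !indicE yx.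
Qed.

Fact fibre_count_compact n (A : set XN) :
  compact (closure [set x | fibre_count n A x != 0]).
Proof. by apply: subclosed_compact kX _ => //; exact: closed_closure. Qed.

Fact fibre_count_ge0 n (A : set XN) x : 0 <= fibre_count n A x.
Proof. by apply: sumr_ge0 => k _; rewrite indicE. Qed.

(** The counting function of [A], as an element of C_c(X, Z)^+. *)
Definition rs_count (A : rs_set X) : CcZplus X :=
  MkCcZplus (fibre_count_continuous (rs_levelP A))
    (@fibre_count_compact (rs_level A) A)
    (@fibre_count_ge0 (rs_level A) A).

Lemma rs_countE (A : rs_set X) (I : finType) (C : I -> set X)
    (u : I -> nat) x :
  is_disjoint_union A (fun i => C i `*` [set u i]) ->
  rs_count A x = \sum_i \1_(C i) x.
Proof. by move=> dA; exact: (fibre_countE x (rs_levelP A) dA). Qed.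

Lemma rs_count0 : rs_count (rs_zero X) =1 Cc_zero X.
Proof.
move=> x; rewrite (@rs_countE _ 'I_0 (fun=> set0) (fun=> 0%N)) ?big_ord0//.
by apply/disjoint_unionP; split=> [[]||? []].
Qed.

Lemma rs_count_add (A B : rs_set X) :
  rs_count (rs_add A B) =1 Cc_add (rs_count A) (rs_count B).
Proof.
move=> x; have hA := rs_levelP A; have hB := rs_levelP B.
have [SA AS Aij] := (disjoint_unionP _ _).1 (layered_disjoint_union hA).
have [SB BS Bij] := (disjoint_unionP _ _).1 (layered_disjoint_union hB).
rewrite (@rs_countE _ ('I_(rs_level A) + 'I_(rs_level B))%type
  (fun k => match k with inl i => fibre A i.+1
                       | inr j => fibre B j.+1 end)
  (fun k => match k with inl i => i.+1
                       | inr j => rs_level A + j.+1 end)%N).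
  by rewrite big_sumType.
apply/disjoint_unionP; split.
- move=> [i|j] [y k] [/= h ->]; first by left.
  by right; apply/shiftP; exists j.+1.
- move=> [y k] [/AS[i [/= h ->]]|/shiftP[l /BS[j [/= h ->]] ->]].
    by exists (inl i).
  by exists (inr j).
- move=> [y k] [i|j] [i'|j'] [/= _ ->] [/= _].
  + by move=> /succn_inj/val_inj ->.
  + by move=> e; have := ltn_ord i; rewrite e addnS ltnNge leq_addr.
  + by move=> e; have := ltn_ord i'; rewrite -e addnS ltnNge leq_addr.
  + by move=> /addnI/succn_inj/val_inj ->.
Qed.

(** The superlevel set [k < f] is put at level [k + 1]. *)
Lemma rs_count_surj (f : CcZplus X) : exists A, rs_count A =1 f.
Proof.
have [n fn] := Cc_bounded f.
have hF i : (1 <= i <= n)%N -> compact_open [set x | (i.-1)%:Z < f x].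
  by move=> _; exact: Cc_level_bounds.
exists (rs_layers hF) => x; rewrite (Cc_level_sum (fn x)).
exact: (rs_countE (A := rs_layers hF) x (layers_disjoint_union n _)).
Qed.

(** * Slices of compact open bisections *)

Lemma slice_open (t : discrete_topology Gamma) (C : set X) :
  open C -> open ([set t] `*` C : set GX).
Proof.
move=> oC; rewrite openE => -[u x] /= [-> Cx].
exists ([set t], C) => //; split; first exact: discrete_set1.
exact: near_open.
Qed.

Lemma src_slice (t : Gamma) (C : set X) :
  @gsrc G @` ([set (t : discrete_topology Gamma)] `*` C) = C.
Proof.
apply/seteqP; split=> [_ [[u x] [/= _ Cx] <-]//|x Cx].
by exists (t, x).
Qed.

Lemma rng_slice (t : Gamma) (C : set X) :
  @grng G @` ([set (t : discrete_topology Gamma)] `*` C) = alpha t @` C.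
Proof.
apply/seteqP; split=> [_ [[u x] [/= -> Cx] <-]|_ [x Cx <-]]; first by exists x.
by exists (t, x).
Qed.

Lemma act_inj (t : Gamma) : injective (alpha t).
Proof.
by apply: (can_inj (g := alpha t^-1%g)) => x; rewrite -actM mulVg act1.
Qed.

Lemma slice_bisection (t : Gamma) (C : set X) : compact_open C ->
  @compact_open_bisection G ([set (t : discrete_topology Gamma)] `*` C).
Proof.
move=> [kC oC]; apply/(@cobP G); split.
- by apply: compact_setX => //; exact: compact_set1.
- exact: slice_open.
- by move=> [u x] [v y] [/= -> _] [/= -> _] /= ->.
- move=> [u x] [v y] [/= -> _] [/= -> _] /= e; congr (_, _).
  exact: act_inj e.
Qed.

(** A compact set meets finitely many slices, as these are open. *)
Lemma compact_fst_finite (E : set GX) : compact E ->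
  exists s : seq Gamma, forall p, E p -> (p.1 : Gamma) \in s.
Proof.
(* Near every point of [E], and for every large enough finite set [s] of
   group elements, first components lie in [s]. *)
pose F := filter_from setT
  (fun s0 : seq Gamma => [set s : seq Gamma | {subset s0 <= s}]).
have FF : Filter F.
  apply: filter_from_filter; first by exists [::].
  move=> s1 s2 _ _; exists (s1 ++ s2) => // s /= s12.
  by split=> t ts; apply: s12; rewrite mem_cat ts ?orbT.
move=> /compact_near_coveringP/(_ _ F (fun s p => (p.1 : Gamma) \in s) FF)[].
  move=> [t x] _; exists ([set t] `*` setT,
    [set s : seq Gamma | {subset [:: (t : Gamma)] <= s}]).
    split; last by exists [:: (t : Gamma)].
    by apply: open_nbhs_nbhs; split => //; apply: slice_open; exact: openT.
  by move=> [[u y] s] /= [[-> _] ts]; apply: ts; rewrite mem_seq1.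
by move=> s _ sE; exists s; exact: sE.
Qed.

Lemma bisection_slice (E : set GX) (t : Gamma) :
  @compact_open_bisection G E ->
  compact_open [set x | E ((t : discrete_topology Gamma), x)].
Proof.
move=> [kE oE _ _].
pose f x : GX := ((t : discrete_topology Gamma), x).
have cf : continuous f.
  by move=> x; apply: (@cvg_pair _ _ _ _ (nbhs (t : discrete_topology Gamma)));
    [exact: cvg_cst|exact: cvg_id].
apply/compact_open_clopen; split.
  by apply: (@open_comp _ _ f E) => // x _; exact: cf.
apply: (@preimage_closed _ _ f E); first by move=> x _; exact: cf.
by apply: compact_closed => //; exact: tg_hausdorff.
Qed.

(** Cutting bisections into slices rewrites the sums of the indicators of their
    sources and ranges as sums over finitely many translations [C_k -> t_k.C_k];
    injectivity of source and range on a bisection makes the sources, and the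
    ranges, of its slices disjoint. *)
Lemma bisection_decomposition n (E : 'I_n -> set GX) :
  (forall i, @compact_open_bisection G (E i)) ->
  exists (N : nat) (C : 'I_N -> set X) (t : 'I_N -> Gamma),
    [/\ forall k, compact_open (C k),
        forall x, \sum_i \1_(@gsrc G @` E i) x = \sum_k \1_(C k) x :> int &
        forall x, \sum_i \1_(@grng G @` E i) x =
                  \sum_k \1_(alpha (t k) @` C k) x :> int].
Proof.
move=> hE.
have fin i : exists s : seq Gamma, forall p, E i p -> (p.1 : Gamma) \in s.
  by apply: compact_fst_finite; case: (hE i).
have [s sE] := boolp.choice fin.
(* The finite set of all group elements that occur in some [E i]. *)
pose S := seq_sub (flatten [seq s i | i <- enum 'I_n]).
have SE i t x : E i (t, x) -> exists w : S, ssval w = t.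
  move=> /sE /= st; suff ts : t \in flatten [seq s i | i <- enum 'I_n].
    by exists (SeqSub ts).
  by apply/flatten_mapP; exists i; rewrite ?mem_enum.
pose C (p : 'I_n * S) :=
  [set x | E p.1 ((ssval p.2 : discrete_topology Gamma), x)].
pose e := @enum_val ('I_n * S)%type predT.
have re (D : 'I_n * S -> set X) x :
    \sum_p \1_(D p) x = \sum_k \1_(D (e k)) x :> int.
  by rewrite (reindex e)//; apply: onW_bij; exact: enum_val_bij.
exists #|{: 'I_n * S}|, (C \o e), (fun k => ssval (e k).2); split=> [k|x|x].
- exact: bisection_slice.
- rewrite -(re C) -(pair_bigA _ (fun i w => \1_(C (i, w)) x)) /=.
  apply: eq_bigr => i _; apply: indic_disjoint_union.
  have [_ _ sI _] := (@cobP G (E i)).1 (hE i).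
  apply/disjoint_unionP; split=> [w y Ey|_ [[t y] Ey <-]|y w w' Ey Ey'].
  + by exists (ssval w, y).
  + by have [w wt] := SE _ _ _ Ey; exists w; rewrite /C/= wt.
  + by apply: val_inj; have [] := sI _ _ Ey Ey' erefl.
- rewrite -(re (fun p => alpha (ssval p.2) @` C p)).
  rewrite -(pair_bigA _ (fun i w => \1_(alpha (ssval w) @` C (i, w)) x)) /=.
  apply: eq_bigr => i _; apply: indic_disjoint_union.
  have [_ _ _ rI] := (@cobP G (E i)).1 (hE i).
  apply/disjoint_unionP; split.
  + by move=> w _ [y Ey <-]; exists (ssval w, y).
  + move=> _ [[t y] Ey <-]; have [w wt] := SE _ _ _ Ey.
    by exists w, y; rewrite /C /= wt.
  + move=> _ w w' [y Ey <-] [y' Ey' /esym yy'].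
    by apply: val_inj; have [] := rI _ _ Ey Ey' yy'.
Qed.

(** * The isomorphism *)

(** The two equivalence relations correspond under counting. *)
Lemma rs_equiv_count (A B : rs_set X) :
  rs_equiv alpha A B <->
  @groupoid_equiv G (rs_count A) (rs_count B).
Proof.
split=> [[l [C [t [n [m [hC hA hB]]]]]]|[n [E [hE hA hB]]]].
  exists l, (fun k => [set (t k : discrete_topology Gamma)] `*` C k); split.
  - by move=> k; exact: slice_bisection.
  - by move=> x; under eq_bigr do rewrite src_slice; exact: rs_countE hA.
  - by move=> x; under eq_bigr do rewrite rng_slice; exact: rs_countE hB.
have [N [C [t [hC sC rC]]]] := bisection_decomposition hE.
(* [U C] and [U (t.C)] are equivalent by definition, and have the same
   counts as [A] and [B] respectively. *)
pose U (D : 'I_N -> set X) : set XN := \bigcup_k (D k `*` [set (k : nat)]).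
have UD D : is_disjoint_union (U D) (fun k => D k `*` [set (k : nat)]).
  split=> //; apply/trivIsetP => i j _ _ /eqP ij.
  apply/seteqP; split=> // -[x k] [[/= _ ->] [/= _ /val_inj]]; exact: ij.
have htC k : compact_open (alpha (t k) @` C k) by exact: act_compact_open.
have eqU (D : 'I_N -> set X) (A' : rs_set X) : (forall k, compact_open (D k)) ->
    (forall x, rs_count A' x = \sum_k \1_(D k) x) -> rs_equiv alpha A' (U D).
  move=> hD A'D; apply: (rs_equiv_indic_sum _ hD
    (layered_disjoint_union (rs_levelP A')) (UD D) A'D).
  by move=> k; exact: layered_fibre (rs_levelP A').
have AC : rs_equiv alpha A (U C).
  by apply: eqU => // x; rewrite -sC; exact: hA.
have BC : rs_equiv alpha B (U (fun k => alpha (t k) @` C k)).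
  by apply: eqU => // x; rewrite -rC; exact: hB.
apply: (rs_equiv_trans hX AC); apply: (rs_equiv_trans hX _ (rs_equiv_sym BC)).
by exists N, C, t, (fun k => k : nat), (fun k => k : nat); split.
Qed.

End TransformationTypeSemigroup.

Theorem proposition8p1 (Gamma : groupType) (X : topologicalType)
    (alpha : homeo_action Gamma X)
    (kX : compact [set: X]) (hX : hausdorff_space X)
    (tX : totally_disconnected [set: X])
    (sX : @second_countable (discrete_topology Gamma * X)%type) :
  exists phi : type_semigroup (transformation_groupoid alpha kX hX tX sX) ->
               action_type_semigroup alpha hX,
    preordered_monoid_iso phi.
Proof.
set G := transformation_groupoid _ _ _ _ _.
suff [psi /preordered_monoid_iso_inv//] :
    exists psi : action_type_semigroup alpha hX -> type_semigroup G,
      preordered_monoid_iso psi.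
apply: (@quotient_monoid_iso (rs_preMonoid alpha hX) (groupoid_preMonoid G)
  (@rs_count X kX hX)).
- move=> A B; exact: rs_equiv_count.
- move=> f; have [A Af] := rs_count_surj kX hX f.
  by exists A; exact: groupoid_equiv_ext.
- exact/groupoid_equiv_ext/rs_count0.
- by move=> A B; exact/groupoid_equiv_ext/rs_count_add.
Qed.
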